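(* There exist a field $k$ and a division algebra $D$ with center $k$ (finite-dimensional over $k$) such that the genus $\mathrm{Gen}(D)$ is infinite.
   Context: All division algebras are finite-dimensional over their centers. Let $D$ be a division algebra with center $k$. The maximal subfields of $D$ are the maximal elements of the poset of fields $E$ with $k\subset E\subset D$. The maximal subfield spectrum of $D$ is the set $\mathrm{Max}(D)$ of isomorphism classes (as field extensions of $k$) of maximal subfields of $D$. Two division algebras $D, D'$ with center $k$ are called weakly isomorphic if $\mathrm{Max}(D)=\mathrm{Max}(D')$. The genus of $D$ is the set $\mathrm{Gen}(D)$ of isomorphism classes (as $k$-algebras) of division algebras $D'$ with center $k$ that are weakly isomorphic to $D$. *)

(* Defs.v *)
From HB Require Import structures.
From mathcomp Require Export all_boot all_order all_algebra all_field.

Set Implicit Arguments.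
Unset Strict Implicit.
Unset Printing Implicit Defensive.

Import GRing.Theory.

Local Open Scope ring_scope.

(* [falgType k] lives in too large a universe for [set] and [finite_set] of
   [mathcomp.classical], so sets of isomorphism classes are plain predicates. *)
Definition finite_pred (T : Type) (A : T -> Prop) : Prop :=
  exists (n : nat) (c : 'I_n -> T), forall x, A x -> exists i, c i = x.

Definition infinite_pred (T : Type) (A : T -> Prop) : Prop := ~ finite_pred A.

Section Genus.
Variable k : fieldType.
Implicit Types A B D : falgType k.

Definition algebra_iso A B : Prop :=
  exists f : {lrmorphism A -> B}, bijective f.

Definition iso_class A : falgType k -> Prop := fun B => algebra_iso A B.

(* [GRing.field_axiom] says that nonzero elements are units; it does not
   involve commutativity. *)
Definition is_division A : Prop := GRing.field_axiom A.

Definition is_field A : Prop :=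
  commutative (@GRing.mul A) /\ is_division A.

(* [1%VS] is the line spanned by 1, i.e. the image of [k] in [D]. *)
Definition is_central D : Prop := 'Z({:D})%VS = 1%VS.

Definition central_division D : Prop := is_division D /\ is_central D.

(* A ring between [k] and [D] is a [k]-subspace of [D], hence an element of
   [{aspace D}] containing [1%VS]; the inclusion is required explicitly because
   the identity of an [{aspace D}] need not be 1. *)
Definition is_subfield D (E : {aspace D}) : Prop :=
  (1 <= E)%VS /\ is_field (subvs_of E).

Definition is_maximal_subfield D (E : {aspace D}) : Prop :=
  is_subfield E /\
  forall F : {aspace D}, is_subfield F -> (E <= F)%VS -> F = E.

(* An isomorphism of field extensions of [k] is an isomorphism of
   [k]-algebras, so classes may be taken among all of [falgType k]. *)
Definition Max D : (falgType k -> Prop) -> Prop :=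
  fun c => exists2 E : {aspace D},
    is_maximal_subfield E & c = iso_class (subvs_of E).

Definition weakly_isomorphic D D' : Prop := Max D = Max D'.

Definition Gen D : (falgType k -> Prop) -> Prop :=
  fun c => exists2 D' : falgType k,
    central_division D' /\ weakly_isomorphic D D' & c = iso_class D'.

End Genus.

(* Main.v *)
From HB Require Import structures.
Require Import Defs.
From mathcomp Require Import boolp generic_quotient ring zify.

(** The algebras with infinite genus are quaternion algebras (-1, c) over a
    field k of characteristic other than 2.  Such an algebra is division
    exactly when c is not a sum of two squares, its maximal subfields are the
    fields k(sqrt d) with d a nonsquare of the form c (y^2 + z^2) - x^2, and
    (-1, c) and (-1, c') are isomorphic only if c c' is a sum of two squares
    ([quat_iso_sum2]).  So it suffices to find k such that

    - the nonzero sums of two squares have infinite index in the nonzero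
      elements of k;
    - every nonsquare d has the form c (y^2 + z^2) - x^2 for every nonzero c.

    By the second property every division algebra (-1, c) has all quadratic
    extensions of k as its maximal subfields, so any two of them are weakly
    isomorphic ([Max_sub]); the first provides infinitely many of them.

    The field k is the limit of a tower.  Each step makes one equation
    d + x^2 = c (y^2 + z^2) solvable without making any element of the
    previous field a new sum of two squares.  It is convenient to work with
    K = k(i) and its conjugation sigma: k is the fixed field, and sums of two
    squares are the norms z sigma(z).  A step is then purely transcendental.
    One first adjoins x with sigma(x) = x, sets h = (d + x^2) / c, and then
    adjoins w with sigma(w) = h / w, so that h is the norm of w.  On fixed
    fields the second extension is the function field of the conic
    y^2 + z^2 = h.  By [isnorm_conic], an element e of k that becomes a norm is
    such that e or e h was already a norm from K(x).  The first case gives that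
    e is a norm from K, by comparing leading coefficients
    ([isnorm_conjX_const]).  The second case is impossible ([odd_not_norm]):
    since d is not a square in k, x^2 + d divides norms to even powers only
    ([anisotropic_quadratic]), whereas it divides e h exactly once.

    The tower starts with the algebraic numbers with an indeterminate X
    adjoined, where neither X - j nor (X - j) (X - l) is a norm for integers
    j <> l.  All its fields are countable, so the steps can be scheduled to
    treat every pair (c, d) that ever occurs; the direct limit has the two
    required properties ([linked_sums_of_squares]). *)

Set Implicit Arguments.
Unset Strict Implicit.
Unset Printing Implicit Defensive.

Import GRing.Theory.

Local Open Scope ring_scope.
Local Open Scope quotient_scope.

Local Notation "x %:F" := (FracField.tofrac x) (format "x %:F").

(** * Maps out of fraction fields *)

Section FractionMaps.
Variable R : idomainType.

Lemma fracE (x : {fraction R}) : x = (\n_(repr x))%:F / (\d_(repr x))%:F.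
Proof.
have d0 : (\d_(repr x))%:F != 0 by rewrite tofrac_eq0 denom_ratioP.
apply: (canRL (mulfK d0)); rewrite -{1}[x]reprK; move: (repr x) => r.
unlock FracField.tofrac; rewrite -[LHS]FracField.pi_mul.
apply/eqmodP => /=; rewrite FracField.equivfE /FracField.mulf.
by rewrite !numden_Ratio ?oner_neq0 ?mulr1 ?mulf_neq0 ?denom_ratioP //= mulrC.
Qed.

Lemma fracP (x : {fraction R}) : exists a b : R, b != 0 /\ x = a%:F / b%:F.
Proof. by exists \n_(repr x), \d_(repr x); rewrite denom_ratioP -fracE. Qed.

Variables (L : fieldType) (phi : {rmorphism R -> L}).

(** Sealed, because unification would otherwise see every value of this map as
    a quotient. *)
Definition fracmap (inj : forall a, phi a = 0 -> a = 0) (x : {fraction R}) : L :=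
  locked (phi \n_(repr x) / phi \d_(repr x)).

Hypothesis inj : forall a, phi a = 0 -> a = 0.
Local Notation fm := (fracmap inj).

Let phi_neq0 a : a != 0 -> phi a != 0.
Proof. by apply: contra_neq => /inj. Qed.

Lemma fracmap_div a b : b != 0 -> fm (a%:F / b%:F) = phi a / phi b.
Proof.
move=> b0; set x := a%:F / b%:F; rewrite /fracmap -lock.
have d0 := denom_ratioP (repr x).
have F0 : (\d_(repr x))%:F != 0 by rewrite tofrac_eq0.
have b0' : b%:F != 0 by rewrite tofrac_eq0.
have := fracE x => /eqP; rewrite {1}/x eqr_div // -!tofracM tofrac_eq => /eqP E.
by apply/eqP; rewrite eqr_div ?phi_neq0 // -!rmorphM E.
Qed.

Lemma fracmap_tofrac a : fm a%:F = phi a.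
Proof.
have := fracmap_div a (oner_neq0 R).
by rewrite tofrac1 rmorph1 !divr1.
Qed.

Fact fracmap_zmod : zmod_morphism fm.
Proof.
move=> x y; have [a [b [b0 ->]]] := fracP x; have [c [d [d0 ->]]] := fracP y.
rewrite -mulNr -tofracN addf_div ?tofrac_eq0 // -!tofracM -tofracD.
rewrite !fracmap_div ?mulf_neq0 // -mulNr addf_div ?phi_neq0 //.
by rewrite !(rmorphD, rmorphM, rmorphN).
Qed.

Fact fracmap_monoid : monoid_morphism fm.
Proof.
split; first by rewrite -tofrac1 fracmap_tofrac rmorph1.
move=> x y; have [a [b [b0 ->]]] := fracP x; have [c [d [d0 ->]]] := fracP y.
rewrite mulf_div -!tofracM !fracmap_div ?mulf_neq0 // mulf_div.
by rewrite !rmorphM.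
Qed.

HB.instance Definition _ := GRing.isZmodMorphism.Build {fraction R} L fm fracmap_zmod.
HB.instance Definition _ := GRing.isMonoidMorphism.Build {fraction R} L fm fracmap_monoid.
End FractionMaps.

Fact frac_reprK (R : idomainType) :
  cancel (fun x : {fraction R} => frac (repr x))
         (fun p => \pi_({fraction R}) (Ratio p.1 p.2)).
Proof. by move=> x; rewrite Ratio_numden reprK. Qed.

HB.instance Definition _ (R : countIdomainType) :=
  Countable.copy {fraction R} (can_type (@frac_reprK R)).

(** * Norms of an involution, and the extension to K(X) fixing X *)

Section Norms.
Variables (K : fieldType) (s : {rmorphism K -> K}).

Definition isnorm (e : K) : Prop := exists z, e = z * s z.

Lemma isnormM a b : isnorm a -> isnorm b -> isnorm (a * b).
Proof. by move=> [x ->] [y ->]; exists (x * y); rewrite rmorphM mulrACA. Qed.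

Lemma isnormV a : isnorm a -> isnorm a^-1.
Proof. by move=> [x ->]; exists x^-1; rewrite fmorphV invfM. Qed.

Lemma isnorm_sqr a : s a = a -> isnorm (a ^+ 2).
Proof. by move=> sa; exists a; rewrite sa expr2. Qed.

(** Powers h^(2m) are norms, namely of the fixed elements h^m, so that only the
    parity of n matters. *)
Lemma isnorm_exp_odd (e h : K) n : s h = h -> h != 0 ->
  isnorm (e * h ^+ n) -> isnorm e \/ isnorm (e * h).
Proof.
move=> sh h0; rewrite -[n]odd_double_half exprD -mul2n exprM => N.
have N2 : isnorm ((h ^+ 2) ^+ n./2)^-1.
  by apply: isnormV; rewrite exprAC; apply: isnorm_sqr; rewrite rmorphXn sh.
move: (isnormM N N2); rewrite -!mulrA mulfV ?mulr1; last by rewrite !expf_neq0.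
by case: odd; rewrite /= ?expr0 ?mulr1 ?expr1; [right | left].
Qed.

Definition fixX_poly : {rmorphism {poly K} -> {fraction {poly K}}} :=
  @FracField.tofrac {poly K} \o map_poly s.

Lemma fixX_poly_inj p : fixX_poly p = 0 -> p = 0.
Proof. by move/eqP; rewrite tofrac_eq0 map_poly_eq0 => /eqP. Qed.

Definition conjX : {rmorphism {fraction {poly K}} -> {fraction {poly K}}} :=
  fracmap fixX_poly_inj.

Lemma conjX_tofrac p : conjX p%:F = (map_poly s p)%:F.
Proof. exact: (fracmap_tofrac fixX_poly_inj). Qed.

Hypothesis sK : involutive s.

Lemma map_poly_involutive : involutive (map_poly s).
Proof. by move=> p; apply/polyP => i; rewrite !coef_map /= sK. Qed.

Lemma conjXK : involutive conjX.
Proof.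
move=> x; have [p [q [q0 ->]]] := fracP x.
by rewrite !fmorph_div !conjX_tofrac !map_poly_involutive.
Qed.
End Norms.

Section ConjX.
Variables (K : fieldType) (s : {rmorphism K -> K}).
Local Notation "p ^s" := (map_poly s p) (at level 2, format "p ^s").

Lemma isnorm_conjXP (f : {poly K}) : isnorm (conjX s) f%:F ->
  exists P Q : {poly K}, Q != 0 /\ f * (Q * Q^s) = P * P^s.
Proof.
case=> z; have [P [Q [Q0 ->]]] := fracP z.
rewrite fmorph_div !conjX_tofrac mulf_div => E.
have Q1 : Q%:F * (Q^s)%:F != 0 by rewrite -tofracM tofrac_eq0 mulf_neq0 ?map_poly_eq0.
exists P, Q; split=> //; apply/eqP; rewrite -tofrac_eq 3!tofracM E.
by rewrite divfK // -tofracM.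
Qed.

(** The leading coefficient of a norm is a norm. *)
Lemma isnorm_conjX_const (e : K) : isnorm (conjX s) (e%:P)%:F -> isnorm s e.
Proof.
move/isnorm_conjXP => [P [Q [Q0 E]]].
have := congr1 lead_coef E; rewrite !lead_coefM !lead_coef_map lead_coefC => E'.
exists (lead_coef P / lead_coef Q).
have q0 : lead_coef Q != 0 by rewrite lead_coef_eq0.
have q1 : s (lead_coef Q) != 0 by rewrite fmorph_eq0.
by rewrite fmorph_div mulf_div -E' mulfK // mulf_neq0.
Qed.

(** The last hypothesis on p says that p is inert: it occurs in P P^s to an even
    power, since it divides P and P^s equally often.  But p * g contains p
    exactly once.  The proof is the corresponding infinite descent. *)
Lemma odd_not_norm (p g : {poly K}) :
  p^s = p -> (1 < size p)%N -> coprimep p g -> g != 0 ->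
  (forall P : {poly K}, p %| P * P^s -> p %| P) -> ~ isnorm (conjX s) (p * g)%:F.
Proof.
move=> ps szp cop g0 H /isnorm_conjXP [P [Q [Q0]]].
have p0 : p != 0 by rewrite -size_poly_gt0; apply: ltn_trans szp.
suff main n : forall P Q : {poly K}, Q != 0 -> (size P <= n)%N -> p * g * (Q * Q^s) <> P * P^s.
  exact: (main (size P)).
elim: n => [|n IHn] {Q0} {}P {}Q Q0.
  rewrite leqn0 size_poly_eq0 => /eqP -> /eqP.
  by rewrite mul0r !mulf_eq0 map_poly_eq0 (negPf p0) (negPf g0) (negPf Q0).
move=> szP E.
have /dvdpP[P1 EP] : p %| P by apply: H; rewrite -E -mulrA dvdp_mulr.
have E1 : g * (Q * Q^s) = p * (P1 * P1^s).
  apply: (mulfI p0); rewrite [LHS]mulrA E EP rmorphM /= ps; ring.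
have /dvdpP[Q1 EQ] : p %| Q.
  by apply: H; rewrite -(Gauss_dvdpr _ cop) E1 dvdp_mulr.
have Q10 : Q1 != 0 by apply: contraNneq Q0 => Q10; rewrite EQ Q10 mul0r.
apply: (IHn P1 Q1 Q10); last first.
  apply: (mulfI p0); rewrite -E1 EQ rmorphM /= ps; ring.
have [->|P10] := eqVneq P1 0; first by rewrite size_poly0.
rewrite -ltnS; apply: leq_trans szP; rewrite EP size_mul //.
by rewrite -(ltn_predK szp) addnS /= -addn1 leq_add2l -ltnS (ltn_predK szp).
Qed.
End ConjX.

(** * The function field of a conic *)

Lemma expr_div_cancel (L : fieldType) (c H w : L) m i : w != 0 ->
  c * (H / w) ^+ m * w ^+ (m + i) = c * H ^+ m * w ^+ i.
Proof.
move=> w0; rewrite exprMn exprD exprVn -!mulrA; congr (_ * (_ * _)).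
by rewrite mulKf // expf_neq0.
Qed.

Lemma mul_divK (L : fieldType) (w H : L) : w != 0 -> w * (H / w) = H.
Proof. by move=> w0; rewrite mulrC divfK. Qed.

Lemma mul_both_sides (L : fieldType) (p p' q q' e u v : L) :
  p * p' = e * (q * q') -> p * (p' * u) * v = e * (q * (q' * v)) * u.
Proof.
by move=> E; rewrite mulrA E; ring.
Qed.

Lemma norm_split_power (L : fieldType) (p p' q q' u v e : L) a b :
  u != 0 -> v != 0 -> q != 0 -> q' != 0 ->
  e = (p * u ^+ a) / (q * u ^+ b) * ((p' * v ^+ a) / (q' * v ^+ b)) ->
  p * p' = e * (u * v) ^+ b / (u * v) ^+ a * (q * q').
Proof.
move=> u0 v0 q0 q'0 ->; rewrite !exprMn.
have [ua ub va vb] : [/\ u ^+ a != 0, u ^+ b != 0, v ^+ a != 0 & v ^+ b != 0].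
  by rewrite !expf_neq0.
by field; rewrite ua ub va vb q0 q'0.
Qed.

Lemma cancel_div (L : fieldType) (a b g : L) : g != 0 -> (a * g) / (b * g) = a / b.
Proof. by move=> g0; rewrite -mulf_div divff // mulr1. Qed.

Section Conic.
Variables (K : fieldType) (s : {rmorphism K -> K}).
Hypothesis sK : involutive s.
Variable h : K.
Hypotheses (sh : s h = h) (h0 : h != 0).

Local Notation KX := {fraction {poly K}}.
Local Notation w := ('X%:F : KX).
Local Notation C a := (a%:P%:F : KX).

Let w0 : w != 0. Proof. by rewrite tofrac_eq0 polyX_eq0. Qed.

Definition conj_coef : {rmorphism K -> KX} :=
  @FracField.tofrac {poly K} \o (@polyC K \o s).

(** The conjugation of K(w) with w |-> h / w.  If sigma is the conjugation of
    K = k(i) and w = y + i z, the fixed field is the function field over k of the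
    conic y^2 + z^2 = h; the conic has a point over K, which is why its function
    field becomes rational. *)
Definition conic_poly : {rmorphism {poly K} -> KX} :=
  horner_morph (fun x => mulrC (C h / w) (conj_coef x)).

(** The conjugate of p multiplied by w^(deg p), which is again a polynomial
    because sigma(w) = h / w. *)
Definition rev_conj (p : {poly K}) : {poly K} :=
  \poly_(i < size p) (s p`_((size p).-1 - i) * h ^+ ((size p).-1 - i)).

Lemma conic_polyE p : conic_poly p * w ^+ (size p).-1 = (rev_conj p)%:F.
Proof.
rewrite /conic_poly /= /horner_morph horner_coef size_map_poly.
rewrite /rev_conj poly_def rmorph_sum /= mulr_suml.
rewrite (reindex_inj rev_ord_inj) /=; apply: eq_bigr => i _.
have szp : (i < size p)%N by [].
rewrite coef_map /= subnS -mul_polyC !rmorphM /= !rmorphXn /=.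
have -> : ((size p - i).-1 = (size p).-1 - i)%N by rewrite -subn1 subnAC subn1.
have -> : ((size p).-1 = ((size p).-1 - i) + i)%N.
  by rewrite subnK // -ltnS (ltn_predK szp).
by rewrite addnK expr_div_cancel.
Qed.

(** The constant coefficient of the reversed polynomial is the conjugate of the
    leading coefficient of p, times a power of h. *)
Lemma rev_conj_eq0 p : rev_conj p = 0 -> p = 0.
Proof.
have [-> //|p0] := eqVneq p 0.
move/(congr1 (fun q : {poly K} => q`_0)).
rewrite coef_poly coef0 size_poly_gt0 p0 subn0 => /eqP.
by rewrite mulf_eq0 fmorph_eq0 expf_eq0 (negPf h0) andbF orbF lead_coef_eq0 => /eqP.
Qed.

Lemma conic_poly_inj p : conic_poly p = 0 -> p = 0.
Proof.
move=> p0; apply: rev_conj_eq0; apply/eqP.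
by rewrite -tofrac_eq0 -conic_polyE p0 mul0r.
Qed.

Definition conjW : {rmorphism KX -> KX} := fracmap conic_poly_inj.

Lemma conjW_tofrac p : conjW p%:F = conic_poly p.
Proof. exact: (fracmap_tofrac conic_poly_inj). Qed.

Lemma conjW_const a : conjW (C a) = C (s a).
Proof. by rewrite conjW_tofrac /conic_poly /= /horner_morph map_polyC hornerC. Qed.

Lemma conjW_mulXn (p : {poly K}) n :
  conjW (p * 'X^n)%:F = conic_poly p * conjW w ^+ n.
Proof. by rewrite tofracM tofracXn rmorphM rmorphXn /= conjW_tofrac. Qed.

Lemma const_frac (e : K) a b :
  C (e * h ^+ b / h ^+ a) = C e * C h ^+ b / C h ^+ a.
Proof.
pose c : {rmorphism K -> KX} := @FracField.tofrac {poly K} \o @polyC K.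
by rewrite -[LHS]/(c _) fmorph_div rmorphM !rmorphXn.
Qed.

Lemma conjW_w : conjW w = C h / w.
Proof. by rewrite conjW_tofrac /conic_poly /= /horner_morph map_polyX hornerX. Qed.

Lemma conjWK : involutive conjW.
Proof.
have wK : conjW (conjW w) = w.
  have Hh : conjW (C h) = C h by rewrite conjW_const sh.
  have H0 : C h != 0 by rewrite tofrac_eq0 polyC_eq0.
  rewrite conjW_w; move: Hh H0; set H := C h => Hh H0.
  by rewrite fmorph_div Hh conjW_w; apply: divKf.
have pK (p : {poly K}) : conjW (conjW p%:F) = p%:F.
  elim/poly_ind: p => [|p c IHp]; first by rewrite tofrac0 !rmorph0.
  by rewrite !rmorphD /= !rmorphM /= IHp wK !conjW_const sK.
move=> x; have [p [q [q0 ->]]] := fracP x.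
by rewrite !fmorph_div !pK.
Qed.

Lemma size_rev_conj p : ~~ root p 0 -> size (rev_conj p) = size p.
Proof.
move=> p00; have p0 : p != 0 by apply: contraNneq p00 => ->; rewrite root0.
have szp : (0 < size p)%N by rewrite size_poly_gt0.
apply: size_poly_eq; rewrite subnn expr0 mulr1 fmorph_eq0 -horner_coef0.
exact: p00.
Qed.

Lemma rev_conj2 p : ~~ root p 0 -> rev_conj (rev_conj p) = h ^+ (size p).-1 *: p.
Proof.
move=> p0; apply/polyP => i; rewrite coefZ {1}/rev_conj coef_poly size_rev_conj //.
case: ltnP => [ip|pi]; last by rewrite nth_default ?mulr0.
have ip' : (i <= (size p).-1)%N by rewrite -ltnS (ltn_predK ip).
rewrite coef_poly (leq_ltn_trans (leq_subr _ _)) ?(ltn_predK ip) //.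
rewrite subKn // rmorphM /= sK rmorphXn /= sh -mulrA -exprD subnKC // mulrC //.
Qed.

Lemma rev_conjZ a p : rev_conj (a *: p) = s a *: rev_conj p.
Proof.
have [->|a0] := eqVneq a 0; first by
  rewrite rmorph0 !scale0r /rev_conj size_poly0 poly_def big_ord0.
apply/polyP => i; rewrite coefZ !coef_poly size_scale // coefZ.
by case: ifP; rewrite ?mulr0 // rmorphM /= mulrA.
Qed.

(** Write p~ for [rev_conj p].  Clearing denominators in e = N(P / Q) gives
    P P~ w^(deg Q) = e Q Q~ w^(deg P).  Reversal keeps the degree of a
    polynomial with nonzero constant term, so P and Q have the same degree and
    P P~ = e Q Q~.  As P is coprime to Q, it divides Q~, whence Q~ = k P for a
    constant k.  Reversing again, h^(deg Q) Q = sigma(k) P~, and substituting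
    this in P P~ = e Q Q~ yields h^(deg Q) = e k sigma(k). *)
Lemma coprime_norm (P Q : {poly K}) e : s e = e -> e != 0 ->
  ~~ root P 0 -> ~~ root Q 0 -> coprimep P Q ->
  P%:F * conic_poly P = C e * (Q%:F * conic_poly Q) ->
  exists n, isnorm s (e * h ^+ n).
Proof.
move=> se e0 P0 Q0 cop E.
have nzP : P != 0 by apply: contraNneq P0 => ->; rewrite root0.
have nzQ : Q != 0 by apply: contraNneq Q0 => ->; rewrite root0.
have E1 : P * rev_conj P * 'X^((size Q).-1) = e%:P * (Q * rev_conj Q) * 'X^((size P).-1).
  apply/eqP; rewrite -tofrac_eq 5!tofracM -!conic_polyE 2!tofracXn; apply/eqP.
  exact: mul_both_sides E.
have nzr p : p != 0 -> rev_conj p != 0.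
  by apply: contra_neq; exact: rev_conj_eq0.
have szE : size P = size Q.
  have /(congr1 (fun p : {poly K} => size p)) := E1.
  rewrite !size_mulXn ?mulf_neq0 ?polyC_eq0 ?nzr //.
  rewrite size_Cmul // !size_mul ?nzr // !size_rev_conj //.
  move: nzP nzQ; rewrite -!size_poly_gt0.
  by move: (size P) (size Q) => a b; lia.
move: E1; rewrite szE => /mulIf; rewrite expf_neq0 ?polyX_eq0 // => /(_ isT) E1.
have PQ : P %| rev_conj Q.
  rewrite -(Gauss_dvdpr _ cop); apply/dvdpP; exists (e^-1%:P * rev_conj P).
  by rewrite -mulrA [rev_conj P * P]mulrC E1 mulrA -polyCM mulVf // mul1r.
have : size P == size (rev_conj Q) by rewrite size_rev_conj ?szE.
rewrite (dvdp_size_eqp PQ) => /eqp_eq.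
set a := lead_coef _; set b := lead_coef _ => Eab.
have b0 : b != 0 by rewrite lead_coef_eq0.
have a0 : a != 0 by rewrite lead_coef_eq0 nzr.
pose k := a / b.
have Ek : rev_conj Q = k *: P.
  by rewrite /k mulrC -scalerA Eab scalerA mulVf // scale1r.
have k0 : k != 0 by rewrite mulf_neq0 ?invr_eq0.
have : rev_conj (rev_conj Q) = s k *: rev_conj P by rewrite Ek rev_conjZ.
rewrite rev_conj2 // => E2.
have E3 : h ^+ (size Q).-1 = e * (k * s k).
  apply: (@polyC_inj K); apply: (mulIf (mulf_neq0 nzQ nzP)).
  rewrite mulrA mul_polyC E2 -mul_polyC -mulrA [rev_conj P * P]mulrC E1 Ek -mul_polyC.
  by rewrite !polyCM; ring.
exists (size Q).-1; exists (e * k); rewrite E3 rmorphM /= se; ring.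
Qed.

(** This is the fact that the classes of quaternion algebras split by the
    function field of a conic are 0 and the class of that conic.  A general
    element is w^(a - b) P / Q with P and Q as in [coprime_norm], and N(w) = h. *)
Lemma isnorm_conic e : s e = e -> isnorm conjW (C e) -> isnorm s e \/ isnorm s (e * h).
Proof.
move=> se.
have [->|e0] := eqVneq e 0; first by left; exists 0; rewrite mul0r.
case=> z; have [A [B [B0 Ez]]] := fracP z.
move=> Ee; have A0 : A != 0.
  apply: contraNneq e0 => A0; move: Ee.
  by rewrite Ez A0 tofrac0 !mul0r => /eqP; rewrite tofrac_eq0 polyC_eq0.
have [g [g0 /dvdpP[A1 EA] /dvdpP[B1 EB] cop]] : exists g,
    [/\ g != 0, g %| A, g %| B & coprimep (A %/ g) (B %/ g)].
  exists (gcdp A B); rewrite gcdp_eq0 negb_and A0 dvdp_gcdl dvdp_gcdr.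
  by rewrite coprimep_div_gcd ?A0.
rewrite EA EB !mulpK // in cop.
have A10 : A1 != 0 by apply: contraNneq A0 => H; rewrite EA H mul0r.
have B10 : B1 != 0 by apply: contraNneq B0 => H; rewrite EB H mul0r.
have {}Ez : z = A1%:F / B1%:F.
  by rewrite Ez EA EB 2!tofracM cancel_div ?tofrac_eq0.
(* Powers of w have no reversal of the same degree and are split off. *)
have [a [P P0 EP]] := multiplicity_XsubC A1 0.
have [b [Q Q0 EQ]] := multiplicity_XsubC B1 0.
rewrite A10 /= in P0; rewrite B10 /= in Q0.
rewrite subr0 in EP EQ.
have cPQ : coprimep P Q.
  move: cop; rewrite EP EQ coprimepMl !coprimepMr.
  by case/andP => /andP[].
have nzP : P != 0 by apply: contraNneq P0 => ->; rewrite root0.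
have nzQ : Q != 0 by apply: contraNneq Q0 => ->; rewrite root0.
have hn0 n : h ^+ n != 0 by rewrite expf_neq0.
have [|||n N] := @coprime_norm P Q (e * h ^+ b / h ^+ a) _ _ P0 Q0 cPQ.
- by rewrite fmorph_div rmorphM /= se !rmorphXn /= sh.
- by rewrite !mulf_neq0 ?invr_eq0.
- have Nw : w * conjW w = C h by rewrite conjW_w; exact: (mul_divK _ w0).
  have nzcQ : conic_poly Q != 0 by apply: contra_neq nzQ => /conic_poly_inj.
  have nzcw : conjW w != 0.
    by apply: contra_neq w0 => /(congr1 conjW); rewrite conjWK => ->; exact: (rmorph0 conjW).
  have -> : C (e * h ^+ b / h ^+ a) = C e * (w * conjW w) ^+ b / (w * conjW w) ^+ a.
    by rewrite Nw; exact: const_frac.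
  have nzQF : Q%:F != 0 by rewrite tofrac_eq0.
  refine (@norm_split_power _ P%:F (conic_poly P) Q%:F (conic_poly Q) w (conjW w) (C e) a b
           w0 nzcw nzQF nzcQ _).
  by rewrite Ee Ez EP EQ (fmorph_div conjW) !conjW_mulXn !tofracM !tofracXn.
suff : isnorm s (e * h ^+ (n + b + a)) by apply: isnorm_exp_odd.
have := isnormM N (isnorm_sqr (a := h ^+ a) _).
rewrite rmorphXn sh => /(_ erefl); congr isnorm.
by rewrite !exprD; field.
Qed.
End Conic.

(** * Fields with involution and norm-reflecting extensions *)

Section Anisotropic.
Variables (K : fieldType) (s : {rmorphism K -> K}).
Variable i : K.
Hypotheses (i2 : i ^+ 2 = -1) (si : s i = - i).
Local Notation "p ^s" := (map_poly s p) (at level 2, format "p ^s").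

Lemma sqrX_add_size (d : K) : size ('X^2 + d%:P) = 3%N.
Proof. by rewrite size_polyDl size_polyXn // size_polyC; case: (d == 0). Qed.

(** Reduce P modulo x^2 + d to a + b x.  If the product with the conjugate
    vanishes modulo x^2 + d, then a sigma(a) = d b sigma(b) and
    a sigma(b) + b sigma(a) = 0; for b <> 0 the quotient u = a / b satisfies
    sigma(u) = - u and u^2 = - d, so that i u is a fixed square root of d. *)
Lemma anisotropic_quadratic (d : K) : s d = d ->
  (forall t, s t = t -> t ^+ 2 <> d) ->
  forall P : {poly K}, 'X^2 + d%:P %| P * P^s -> 'X^2 + d%:P %| P.
Proof.
move=> sd nsq P; set p := 'X^2 + d%:P => pP.
have szp : size p = 3%N := sqrX_add_size d.
have p0 : p != 0 by rewrite -size_poly_gt0 szp.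
have ps : p^s = p by rewrite rmorphD /= map_polyXn map_polyC /= sd.
pose r := P %% p; pose a := r`_0; pose b := r`_1.
have szr : (size r <= 2)%N by rewrite -ltnS -szp ltn_modp.
have Er : r = b *: 'X + a%:P.
  apply/polyP => -[|[|j]]; rewrite coefD coefZ coefX coefC /= ?mulr0 ?mulr1 ?add0r ?addr0 //.
  by rewrite nth_default // (leq_trans szr).
have EP : P = P %/ p * p + r by apply: divp_eq.
have pr : p %| r * r^s.
  move: pP; rewrite EP rmorphD rmorphM /= ps mulrDl dvdp_addr; last first.
    by rewrite dvdp_mulr // dvdp_mull.
  by rewrite mulrDr dvdp_addr // dvdp_mull // dvdp_mull.
have Ers : r^s = s b *: 'X + (s a)%:P.
  by rewrite Er rmorphD /= linearZ /= map_polyX map_polyC.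
pose q := (a * s b + b * s a) *: 'X + (a * s a - d * (b * s b))%:P.
have Eq : r * r^s = (b * s b)%:P * p + q.
  by rewrite Ers Er /q /p -!mul_polyC !(polyCD, polyCB, polyCN, polyCM); ring.
have q0 : q = 0.
  apply: contraTeq pr; rewrite Eq dvdp_addr ?dvdp_mull // => nzq.
  apply/negP => /(dvdp_leq nzq); apply/negP; rewrite -ltnNge szp ltnS.
  apply: leq_trans (size_polyD _ _) _; rewrite geq_max.
  rewrite (leq_trans (size_scale_leq _ _)) ?size_polyX //.
  by rewrite (leq_trans (size_polyC_leq1 _)).
have q1 : a * s b + b * s a = 0.
  by have := congr1 (fun u : {poly K} => u`_1) q0;
    rewrite coefD coefZ coefX coefC /= mulr1 addr0 coef0.
have q2 : a * s a = d * (b * s b).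
  apply/eqP; rewrite -subr_eq0; apply/eqP.
  by have := congr1 (fun u : {poly K} => u`_0) q0;
    rewrite coefD coefZ coefX coefC /= mulr0 add0r coef0.
suff r0 : r = 0 by rewrite EP r0 addr0 dvdp_mull.
have [b0|b0] := eqVneq b 0.
  move/eqP: q2; rewrite b0 mul0r mulr0 mulf_eq0 fmorph_eq0 orbb => /eqP a0.
  by rewrite Er a0 b0 scale0r addr0.
have sb0 : s b != 0 by rewrite fmorph_eq0.
have E1 : s a = - (a * s b / b).
  apply: (mulIf b0); rewrite mulNr divfK // mulrC.
  by apply/eqP; rewrite -addr_eq0 addrC q1.
case: (nsq (i * (a / b))); first by rewrite rmorphM fmorph_div /= si E1; field; rewrite b0 sb0.
rewrite exprMn i2 expr_div_n mulN1r; apply: (mulIf (expf_neq0 2 b0)).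
rewrite mulNr divfK ?expf_neq0 //.
apply: (mulIf sb0); rewrite -[d * _ * _]mulrA expr2.
have -> : d * (b ^+ 2 * s b) = b * (a * s a) by rewrite q2; ring.
by rewrite E1; field.
Qed.
End Anisotropic.

(** The data of K = k(i), where k is the fixed field of the conjugation.
    Countability is needed to enumerate the equations to be solved. *)
Record invField := InvField {
  inv_car :> countFieldType;
  conj : {rmorphism inv_car -> inv_car};
  conjK : involutive conj;
  imag : inv_car;
  imag_sqr : imag ^+ 2 = -1;
  conj_imag : conj imag = - imag }.

Arguments conj {_}.

Definition norm (K : invField) : K -> Prop := isnorm (@conj K).
Definition real (K : invField) (x : K) : Prop := conj x = x.

(** [emb_norm] keeps sums of two squares under control: it lets an element be a
    norm in the limit of a tower only if it was one at the start. *)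
Record extension (K L : invField) := Extension {
  emb :> {rmorphism K -> L};
  emb_conj : forall x, emb (conj x) = conj (emb x);
  emb_norm : forall e, real e -> norm (emb e) -> norm e }.

Lemma extension_id (K : invField) : extension K K.
Proof. by exists idfun. Qed.

Lemma emb_real K L (f : extension K L) x : real x -> real (f x).
Proof. by rewrite /real -emb_conj => ->. Qed.

Section Step.
Variable K : invField.

Definition XField : invField.
Proof.
pose c : {rmorphism K -> {fraction {poly K}}} := @FracField.tofrac {poly K} \o @polyC K.
apply: (@InvField {fraction {poly K}} (conjX (@conj K)) (conjXK (@conjK K)) (c (imag K))).
  by rewrite -(rmorphXn c) imag_sqr (rmorphN1 c).
by rewrite [LHS]conjX_tofrac map_polyC /= conj_imag !rmorphN.
Defined.

Lemma XField_ext : {f : extension K XField | forall x, f x = x%:P%:F}.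
Proof.
pose c : {rmorphism K -> XField} := @FracField.tofrac {poly K} \o @polyC K.
have c1 x : c (conj x) = conj (c x) by rewrite [RHS]conjX_tofrac map_polyC.
have c2 e : real e -> norm (c e) -> norm e by move=> _; apply: isnorm_conjX_const.
by exists (@Extension K XField c c1 c2).
Qed.

Variables h : K.
Hypotheses (sh : real h) (h0 : h != 0).

Definition WField : invField.
Proof.
pose c : {rmorphism K -> {fraction {poly K}}} := @FracField.tofrac {poly K} \o @polyC K.
apply: (@InvField {fraction {poly K}} (conjW (@conj K) h0) (conjWK (@conjK K) sh h0) (c (imag K))).
  by rewrite -(rmorphXn c) imag_sqr (rmorphN1 c).
by rewrite [LHS]conjW_const /= conj_imag !rmorphN.
Defined.
End Step.

Definition fixed_square (K : invField) (d : K) : Prop :=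
  exists t, real t /\ t ^+ 2 = d.

Definition solvable (K : invField) (c d : K) : Prop :=
  exists x z : K, real x /\ d + x ^+ 2 = c * (z * conj z).

Lemma rmorph_conic_eq (A B : fieldType) (g : {rmorphism A -> B}) (c d h x : A) :
  c * h = d + x ^+ 2 -> g d + g x ^+ 2 = g c * g h.
Proof. by rewrite -rmorphXn -rmorphD -rmorphM => ->. Qed.

(** The extension is K(x)(w) with sigma(x) = x, h = (d + x^2) / c and
    sigma(w) = h / w, which solves d + x^2 = c N(w). *)
Lemma step_solve (K : invField) (c d : K) : real c -> real d -> c != 0 ->
  ~ fixed_square d ->
  exists (L : invField) (f : extension K L), solvable (f c) (f d).
Proof.
move=> rc rd c0 nsq; have [f Ef] := XField_ext K.
pose p : {poly K} := 'X^2 + d%:P.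
pose h : XField K := (p * (c^-1)%:P)%:F.
have p_s : map_poly conj p = p by rewrite rmorphD /= map_polyXn map_polyC /= rd.
have p0 : p != 0 by rewrite -size_poly_gt0 sqrX_add_size.
have rh : real h.
  rewrite /real [LHS]conjX_tofrac rmorphM /= p_s map_polyC /= fmorphV.
  by rewrite (_ : conj c = c).
have h0 : h != 0 by rewrite tofrac_eq0 mulf_neq0 // polyC_eq0 invr_eq0.
pose L := WField rh h0.
pose g : {rmorphism XField K -> L} :=
  @FracField.tofrac {poly XField K} \o @polyC (XField K).
have g_conj x : g (conj x) = conj (g x) by rewrite [RHS]conjW_const.
pose gf : {rmorphism K -> L} := g \o f.
have gf_conj x : gf (conj x) = conj (gf x) by rewrite -[LHS]/(g (f (conj x))) emb_conj g_conj.
have gf_norm e : real e -> norm (gf e) -> norm e.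
  move=> re Ne; have [->|e0] := eqVneq e 0; first by exists 0; rewrite mul0r.
  have rfe : real (f e) by apply: emb_real.
  case: (isnorm_conic (@conjK _) rh rfe Ne); first exact: emb_norm.
  rewrite Ef mulrC -tofracM -mulrA -polyCM => /odd_not_norm; case=> //.
  - by rewrite sqrX_add_size.
  - by rewrite -[_%:P]alg_polyC coprimepZr ?coprimep1 // mulf_neq0 ?invr_eq0.
  - by rewrite polyC_eq0 mulf_neq0 ?invr_eq0.
  - apply: (anisotropic_quadratic (imag_sqr K) (conj_imag K) rd).
    by move=> t rt td; apply: nsq; exists t.
pose F := @Extension K L gf gf_conj gf_norm.
exists L, F, (g ('X%:F)), ('X%:F); split.
  by rewrite /real -g_conj [conj _]conjX_tofrac map_polyX.
have -> : ('X%:F : L) * conj ('X%:F : L) = g h.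
  have X0 : 'X%:F != 0 :> L by rewrite tofrac_eq0 polyX_eq0.
  have -> : conj ('X%:F : L) = g h / 'X%:F := conjW_w conj h0.
  exact: (mul_divK (g h) X0).
have Efc : f c * h = f d + 'X%:F ^+ 2.
  rewrite !Ef -tofracXn -tofracM -tofracD /p addrC; congr _%:F.
  by rewrite mulrCA -polyCM mulfV // mulr1.
exact: (rmorph_conic_eq g Efc).
Qed.

Definition solved (K : invField) (c d : K) : Prop :=
  real c -> real d -> c != 0 -> fixed_square d \/ solvable c d.

(** An equation once solved stays solved, also when d becomes a square. *)
Lemma solved_emb (K L : invField) (f : extension K L) c d :
  solved c d -> solved (f c) (f d).
Proof.
move=> H rc rd c0.
have realI x : real (f x) -> real x.
  by rewrite /real -emb_conj => /fmorph_inj.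
have {c0} : c != 0 by apply: contra_neq c0 => ->; rewrite rmorph0.
move=> /(H (realI _ rc) (realI _ rd)) [[t [rt <-]]|[x [z [rx E]]]]; [left|right].
  by exists (f t); split; [apply: emb_real | rewrite rmorphXn].
exists (f x), (f z); split; first exact: emb_real.
by rewrite -emb_conj -rmorphM -rmorphM -rmorphXn -rmorphD E.
Qed.

Lemma step (K : invField) (c d : K) :
  exists (L : invField) (f : extension K L), solved (f c) (f d).
Proof.
have [H|H] := pselect (solved c d).
  by exists K, (extension_id K); apply: solved_emb.
have [rc rd c0 nsq] : [/\ real c, real d, c != 0 & ~ fixed_square d].
  split; apply: contrapT => n; apply: H => rc rd c0 //.
  by left; apply: contrapT => n'; apply: n.
have [L [f S]] := step_solve rc rd c0 nsq.
by exists L, f; right.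
Qed.

Definition algC_invField : invField.
Proof.
exact: (@InvField algC (@Num.conj algC) (@Num.Theory.conjCK algC) 'i
        (@Num.Theory.sqrCi algC) (@Num.Theory.conjCi algC)).
Defined.

Definition base_field : invField := XField algC_invField.

Definition base_elt (j : nat) : base_field := ('X - j%:R%:P)%:F.

Lemma base_real j : real (base_elt j).
Proof.
by rewrite /real [LHS]conjX_tofrac rmorphB /= map_polyX map_polyC /= rmorph_nat.
Qed.

(** X - j is inert because j is real: P(j) times its conjugate vanishes only if
    P(j) does. *)
Lemma base_XsubC_mul_not_norm (g : {poly algC}) j : coprimep ('X - j%:R%:P) g -> g != 0 ->
  ~ @norm base_field (('X - j%:R%:P) * g)%:F.
Proof.
move=> cop g0; apply: odd_not_norm => //.
- by rewrite rmorphB /= map_polyX map_polyC /= rmorph_nat.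
- by rewrite size_XsubC.
move=> P; rewrite !dvdp_XsubCl !rootE hornerM.
rewrite -{2}[j%:R](rmorph_nat (@conj algC_invField)) horner_map /=.
by rewrite mulf_eq0 fmorph_eq0 orbb.
Qed.

Lemma base_not_norm j : ~ norm (base_elt j).
Proof.
by rewrite /base_elt -['X - _]mulr1; apply: base_XsubC_mul_not_norm; rewrite ?coprimep1 ?oner_eq0.
Qed.

Lemma base_mul_not_norm j l : j != l -> ~ norm (base_elt j * base_elt l).
Proof.
move=> jl; rewrite /base_elt -tofracM; apply: base_XsubC_mul_not_norm; rewrite ?polyXsubC_eq0 //.
by rewrite coprimep_XsubC2 // subr_eq0 Num.Theory.eqr_nat eq_sym.
Qed.

(** * Direct limits of sequences of fields *)

Section DirectLimit.
Variables (F : nat -> fieldType) (f : forall n, {rmorphism F n -> F n.+1}).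

(** An element of the limit is represented by a sequence that eventually follows
    the maps of the system, up to eventual equality; all operations are then
    pointwise, and no transport between the fields is needed. *)
Definition coherent (u : forall n, F n) : Prop :=
  exists N, forall n, (N <= n)%N -> u n.+1 = f n (u n).

Record cseq := CSeq { cseq_fun :> forall n, F n; cseqP : coherent cseq_fun }.

HB.instance Definition _ := gen_eqMixin cseq.
HB.instance Definition _ := gen_choiceMixin cseq.

Definition eventually_eq (u v : cseq) : Prop :=
  exists N, forall n, (N <= n)%N -> u n = v n.

Definition eqlim (u v : cseq) : bool := `[< eventually_eq u v >].

Lemma eqlim_refl : reflexive eqlim.
Proof. by move=> u; apply/asboolP; exists 0%N. Qed.

Lemma eqlim_sym : symmetric eqlim.
Proof.
by move=> u v; apply/asboolP/asboolP => -[N H]; exists N => n /H.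
Qed.

Lemma eqlim_trans : transitive eqlim.
Proof.
move=> v u w /asboolP[N H] /asboolP[M H']; apply/asboolP; exists (maxn N M) => n.
by rewrite geq_max => /andP[/H -> /H' ->].
Qed.

Canonical eqlim_equiv := EquivRel eqlim eqlim_refl eqlim_sym eqlim_trans.

Definition dirlim := {eq_quot eqlim}.
HB.instance Definition _ : EqQuotient _ eqlim dirlim := EqQuotient.on dirlim.
HB.instance Definition _ := Choice.on dirlim.

Lemma eq_dirlim (u v : cseq) : eventually_eq u v -> \pi_dirlim u = \pi_dirlim v.
Proof. by move=> uv; apply/eqmodP/asboolP. Qed.

Lemma dirlim_eq (u v : cseq) : \pi_dirlim u = \pi_dirlim v -> eventually_eq u v.
Proof. by move/eqmodP/asboolP. Qed.

Lemma repr_dirlim (u : cseq) : eventually_eq (repr (\pi_dirlim u)) u.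
Proof. by apply: dirlim_eq; rewrite reprK. Qed.

Section Pointwise.
Variable op : forall n, F n -> F n -> F n.
Hypothesis opf : forall n x y, f n (op x y) = op (f n x) (f n y).
Fact coherent2 (u v : cseq) : coherent (fun n => op (u n) (v n)).
Proof.
have [[N Hu] [M Hv]] := (cseqP u, cseqP v); exists (maxn N M) => n.
by rewrite geq_max => /andP[/Hu -> /Hv ->]; rewrite opf.
Qed.
Definition cseq2 u v := CSeq (coherent2 u v).
Definition dirlim2 (x y : dirlim) : dirlim :=
  locked (\pi_dirlim (cseq2 (repr x) (repr y))).
Lemma dirlim2E u v : dirlim2 (\pi_dirlim u) (\pi_dirlim v) = \pi_dirlim (cseq2 u v).
Proof.
rewrite /dirlim2 -lock; apply: eq_dirlim; have [[N Hu] [M Hv]] := (repr_dirlim u, repr_dirlim v).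
by exists (maxn N M) => n; rewrite geq_max => /andP[/Hu /= -> /Hv ->].
Qed.
End Pointwise.

Section Pointwise1.
Variable op : forall n, F n -> F n.
Hypothesis opf : forall n x, f n (op x) = op (f n x).
Fact coherent1 (u : cseq) : coherent (fun n => op (u n)).
Proof. by have [N Hu] := cseqP u; exists N => n /Hu ->; rewrite opf. Qed.
Definition cseq1 u := CSeq (coherent1 u).
Definition dirlim1 (x : dirlim) : dirlim := locked (\pi_dirlim (cseq1 (repr x))).
Lemma dirlim1E u : dirlim1 (\pi_dirlim u) = \pi_dirlim (cseq1 u).
Proof.
rewrite /dirlim1 -lock; apply: eq_dirlim.
by have [N Hu] := repr_dirlim u; exists N => n /Hu /= ->.
Qed.
End Pointwise1.

Definition cseq0 : cseq.
Proof. by exists (fun n => 0); exists 0%N => n _; rewrite rmorph0. Defined.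
Definition cseq_one : cseq.
Proof. by exists (fun n => 1); exists 0%N => n _; rewrite rmorph1. Defined.

Definition limD := dirlim2 (op := fun n => +%R) (fun n => rmorphD (f n)).
Definition limM := dirlim2 (op := fun n => *%R) (fun n => rmorphM (f n)).
Definition limN := dirlim1 (op := fun n => -%R) (fun n => rmorphN (f n)).
Definition limV := dirlim1 (op := fun n => @GRing.inv (F n)) (fun n => fmorphV (f n)).
Definition lim0 : dirlim := \pi_dirlim cseq0.
Definition lim1 : dirlim := \pi_dirlim cseq_one.
Definition limE := (dirlim2E (op := fun n => +%R) (fun n => rmorphD (f n)),
  dirlim2E (op := fun n => *%R) (fun n => rmorphM (f n)),
  dirlim1E (op := fun n => -%R) (fun n => rmorphN (f n)),
  dirlim1E (op := fun n => @GRing.inv (F n)) (fun n => fmorphV (f n))).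

Fact limDA : associative limD.
Proof.
elim/quotW=> x; elim/quotW=> y; elim/quotW=> z; rewrite /limD !limE.
by apply: eq_dirlim; exists 0%N => n _ /=; rewrite addrA.
Qed.
Fact limDC : commutative limD.
Proof.
elim/quotW=> x; elim/quotW=> y; rewrite /limD !limE.
by apply: eq_dirlim; exists 0%N => n _ /=; rewrite addrC.
Qed.
Fact lim0D : left_id lim0 limD.
Proof.
elim/quotW=> x; rewrite /limD !limE.
by apply: eq_dirlim; exists 0%N => n _ /=; rewrite add0r.
Qed.
Fact limND : left_inverse lim0 limN limD.
Proof.
elim/quotW=> x; rewrite /limD /limN !limE.
by apply: eq_dirlim; exists 0%N => n _ /=; rewrite addNr.
Qed.
HB.instance Definition _ := GRing.isZmodule.Build dirlim limDA limDC lim0D limND.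

Fact limMA : associative limM.
Proof.
elim/quotW=> x; elim/quotW=> y; elim/quotW=> z; rewrite /limM !limE.
by apply: eq_dirlim; exists 0%N => n _ /=; rewrite mulrA.
Qed.
Fact limMC : commutative limM.
Proof.
elim/quotW=> x; elim/quotW=> y; rewrite /limM !limE.
by apply: eq_dirlim; exists 0%N => n _ /=; rewrite mulrC.
Qed.
Fact lim1M : left_id lim1 limM.
Proof.
elim/quotW=> x; rewrite /limM !limE.
by apply: eq_dirlim; exists 0%N => n _ /=; rewrite mul1r.
Qed.
Fact limMD : left_distributive limM limD.
Proof.
elim/quotW=> x; elim/quotW=> y; elim/quotW=> z; rewrite /limM /limD !limE.
by apply: eq_dirlim; exists 0%N => n _ /=; rewrite mulrDl.
Qed.
Fact lim1_neq0 : lim1 != lim0.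
Proof.
apply/eqP => /dirlim_eq[N /(_ N (leqnn N)) /= /eqP].
by rewrite oner_eq0.
Qed.
HB.instance Definition _ :=
  GRing.Zmodule_isComNzRing.Build dirlim limMA limMC lim1M limMD lim1_neq0.

(** A coherent sequence that vanishes at one late stage vanishes from there on,
    so the terms of a nonzero one are eventually invertible. *)
Fact limVM (x : dirlim) : x != 0 -> limV x * x = 1.
Proof.
elim/quotW: x => x x0; rewrite /limV limE.
rewrite [LHS]limE; apply: eq_dirlim.
have [N Hx] := cseqP x; exists N => n Nn /=; apply: mulVf.
apply: contra_neq x0 => xn0; apply: eq_dirlim; exists n => m /=.
elim: m => [|m IHm]; first by rewrite leqn0 => /eqP E; move: xn0; rewrite E.
rewrite leq_eqVlt => /orP[/eqP E|nm]; first by rewrite -E.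
by rewrite Hx ?(leq_trans Nn) // IHm // rmorph0.
Qed.
Fact limV0 : limV 0 = 0.
Proof.
by rewrite [LHS]limE; apply: eq_dirlim; exists 0%N => n _ /=; rewrite invr0.
Qed.
HB.instance Definition _ := GRing.ComNzRing_isField.Build dirlim limVM limV0.

Lemma dirlimDE u v : \pi_dirlim u + \pi_dirlim v =
  \pi_dirlim (cseq2 (fun n => rmorphD (f n)) u v).
Proof. exact: dirlim2E. Qed.

Lemma dirlimME u v : \pi_dirlim u * \pi_dirlim v =
  \pi_dirlim (cseq2 (fun n => rmorphM (f n)) u v).
Proof. exact: dirlim2E. Qed.

Lemma dirlimNE u : - \pi_dirlim u = \pi_dirlim (cseq1 (fun n => rmorphN (f n)) u).
Proof. exact: dirlim1E. Qed.

(** The cast is needed since the index m equals n only propositionally. *)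
Definition cast_or0 n (a : F n) m : F m :=
  if @eqP _ n m is ReflectT e then ecast k (F k) e a else 0.

Lemma cast_or0_id n (a : F n) : cast_or0 a n = a.
Proof. by rewrite /cast_or0; case: eqP => // e; rewrite eq_axiomK. Qed.

(** The standard representative of the image of a in the limit. *)
Fixpoint tail_from n (a : F n) m : F m :=
  match m with
  | 0 => cast_or0 a 0
  | m'.+1 => if n == m'.+1 then cast_or0 a m'.+1 else f m' (tail_from a m')
  end.

Arguments tail_from : simpl never.

Lemma tail_from_id n (a : F n) : tail_from a n = a.
Proof. by case: n a => [|n] a; rewrite /tail_from ?eqxx cast_or0_id. Qed.

Lemma tail_fromS n (a : F n) m : (n <= m)%N -> tail_from a m.+1 = f m (tail_from a m).
Proof. by move=> nm; rewrite {1}/tail_from; case: eqP => // E; rewrite E ltnn in nm. Qed.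

Fact coherent_tail_from n (a : F n) : coherent (tail_from a).
Proof. by exists n => m; exact: tail_fromS. Qed.

Definition emblim n (a : F n) : dirlim := \pi_dirlim (CSeq (coherent_tail_from a)).

Lemma tail_from_ind n (P : forall m, F m -> Prop) (a : F n) :
  P n a -> (forall m x, (n <= m)%N -> P m x -> P m.+1 (f m x)) ->
  forall m, (n <= m)%N -> P m (tail_from a m).
Proof.
move=> P0 PS; elim=> [|m IHm].
  by rewrite leqn0 => /eqP E; move: (a) P0; rewrite E => b; rewrite tail_from_id.
rewrite leq_eqVlt => /orP[/eqP E|]; first by move: (a) P0; rewrite E => b; rewrite tail_from_id.
by rewrite ltnS => nm; rewrite tail_fromS //; apply: PS => //; apply: IHm.
Qed.

Lemma emblim_eq n (a : F n) (u : cseq) :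
  u n = a -> (forall m, (n <= m)%N -> u m.+1 = f m (u m)) ->
  \pi_dirlim u = emblim a.
Proof.
move=> ua uS; apply: eq_dirlim; exists n => m nm /=; apply/esym; move: m nm.
apply: (@tail_from_ind n (fun m x => x = u m)) => // m x nm ->; by rewrite uS.
Qed.

Lemma emblimS n (a : F n) : emblim (f n a) = emblim a.
Proof.
apply/esym; apply: emblim_eq => /= [|m nm]; last by rewrite tail_fromS // ltnW.
by rewrite tail_fromS // tail_from_id.
Qed.

Lemma dirlimP (x : dirlim) : exists n (a : F n), x = emblim a.
Proof.
elim/quotW: x => u; have [n Hn] := cseqP u; exists n, (u n).
exact: emblim_eq.
Qed.

Lemma dirlimP2 (x y : dirlim) :
  exists n (a b : F n), x = emblim a /\ y = emblim b.
Proof.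
elim/quotW: x => u; elim/quotW: y => v.
have [[n Hu] [m Hv]] := (cseqP u, cseqP v); exists (maxn n m), (u (maxn n m)), (v (maxn n m)).
by split; apply: emblim_eq => // k; rewrite geq_max => /andP[? ?]; auto.
Qed.

Fact emblim_zmod n : zmod_morphism (@emblim n).
Proof.
move=> a b; rewrite [in RHS]/emblim dirlimNE dirlimDE; apply/esym.
apply: emblim_eq => /= [|m nm]; first by rewrite !tail_from_id.
by rewrite !tail_fromS // rmorphB.
Qed.

Fact emblim_monoid n : monoid_morphism (@emblim n).
Proof.
split; first by apply/esym; apply: emblim_eq => //= m _; rewrite rmorph1.
move=> a b; rewrite [in RHS]/emblim dirlimME; apply/esym.
apply: emblim_eq => /= [|m nm]; first by rewrite !tail_from_id.
by rewrite !tail_fromS // rmorphM.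
Qed.

HB.instance Definition _ n := GRing.isZmodMorphism.Build (F n) dirlim (@emblim n) (@emblim_zmod n).
HB.instance Definition _ n :=
  GRing.isMonoidMorphism.Build (F n) dirlim (@emblim n) (@emblim_monoid n).

Variables (s : forall n, {rmorphism F n -> F n}).
Definition limmap (fs : forall n x, f n (s n x) = s n.+1 (f n x)) : dirlim -> dirlim := 
  dirlim1 fs.
Hypothesis fs : forall n x, f n (s n x) = s n.+1 (f n x).
Lemma limmap_emb n (a : F n) : limmap fs (emblim a) = emblim (s n a).
Proof.
rewrite /limmap dirlim1E; apply: emblim_eq => /= [|m nm]; first by rewrite tail_from_id.
by rewrite tail_fromS // fs.
Qed.

Fact limmap_zmod : zmod_morphism (limmap fs).
Proof.
move=> x y; have [n [a [b [-> ->]]]] := dirlimP2 x y.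
by rewrite -rmorphB !limmap_emb -!rmorphB.
Qed.

Fact limmap_monoid : monoid_morphism (limmap fs).
Proof.
split; first by rewrite -(rmorph1 (@emblim 0)) limmap_emb rmorph1.
move=> x y; have [n [a [b [-> ->]]]] := dirlimP2 x y.
by rewrite -rmorphM !limmap_emb -!rmorphM.
Qed.

HB.instance Definition _ := GRing.isZmodMorphism.Build dirlim dirlim (limmap fs) limmap_zmod.
HB.instance Definition _ := GRing.isMonoidMorphism.Build dirlim dirlim (limmap fs) limmap_monoid.
End DirectLimit.

(** * The tower and its limit *)

Lemma step_choice (K : invField) (c d : K) :
  exists p : {L : invField & extension K L}, solved (tagged p c) (tagged p d).
Proof. by have [L [f S]] := step c d; exists (Tagged _ f). Qed.

Definition next (K : invField) (c d : K) : {L : invField & extension K L} :=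
  projT1 (cid (step_choice c d)).

Lemma nextP (K : invField) (c d : K) :
  solved (tagged (next c d) c) (tagged (next c d) d).
Proof. exact: (projT2 (cid (step_choice c d))). Qed.

Definition pairs (K : invField) (k : nat) : K * K := odflt (0, 0) (unpickle k).

Lemma pairs_surj (K : invField) (p : K * K) : exists k, pairs K k = p.
Proof. by exists (pickle p); rewrite /pairs pickleK. Qed.

(** Stage n treats the k-th pair of elements of the m-th field, (m, k) being the
    code read off from the 2-adic valuation of n: thus each code occurs at
    arbitrarily late stages, in particular after its field has been built. *)
Definition task (n : nat) : nat * nat := odflt (0, 0)%N (unpickle (logn 2 n)).

Lemma task_late (m k : nat) : exists2 n, (m <= n)%N & task n = (m, k).
Proof.
exists (2 ^ pickle (m, k) * (2 * m).+1)%N.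
  by have := expn_gt0 2 (pickle (m, k)); nia.
rewrite /task lognM ?expn_gt0 // pfactorK // logn_coprime ?addn0 ?pickleK //.
by rewrite coprime2n /= mul2n odd_double.
Qed.

(** [stage_tasks m k] is the image in the current field of the k-th pair of the
    m-th field.  Carrying these images along avoids composing the maps of the
    tower from one stage to another. *)
Record stage := Stage { stage_field :> invField;
  stage_tasks : nat -> nat -> stage_field * stage_field }.

Definition stage_ext n (S : stage) :=
  let p := stage_tasks S (task n).1 (task n).2 in next p.1 p.2.

Fixpoint tower n : stage :=
  match n with
  | 0 => Stage (fun _ => pairs base_field)
  | n'.+1 =>
    let S := tower n' in let f := tagged (stage_ext n' S) in
    Stage (fun m k => if (m <= n')%N
      then (f (stage_tasks S m k).1, f (stage_tasks S m k).2)
      else pairs (tag (stage_ext n' S)) k)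
  end.

Definition tower_ext n : extension (tower n) (tower n.+1) :=
  tagged (stage_ext n (tower n)).

Lemma tower_solved n (p := stage_tasks (tower n) (task n).1 (task n).2) :
  solved (tower_ext n p.1) (tower_ext n p.2).
Proof. exact: nextP. Qed.

Lemma tower_task_new m k : stage_tasks (tower m) m k = pairs (tower m) k.
Proof. by case: m => //= m; rewrite ltnn. Qed.

Lemma tower_task_old n m k : (m <= n)%N ->
  stage_tasks (tower n.+1) m k = (tower_ext n (stage_tasks (tower n) m k).1,
                                 tower_ext n (stage_tasks (tower n) m k).2).
Proof. by rewrite /= => ->. Qed.

Definition tower_field n : fieldType := tower n.
Definition tower_map n : {rmorphism tower_field n -> tower_field n.+1} := tower_ext n.
Definition tower_conj n : {rmorphism tower_field n -> tower_field n} := @conj (tower n).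

Lemma tower_map_conj n x : tower_map n (tower_conj n x) = tower_conj n.+1 (tower_map n x).
Proof. exact: emb_conj. Qed.

Definition tower_lim : fieldType := dirlim tower_map.
Definition lim_conj : {rmorphism tower_lim -> tower_lim} := limmap tower_map_conj.
Definition tower_in n : {rmorphism tower_field n -> tower_lim} := @emblim tower_field tower_map n.

Lemma tower_inS n (a : tower_field n) : tower_in n.+1 (tower_map n a) = tower_in n a.
Proof. exact: emblimS. Qed.

Lemma lim_conj_in n (a : tower_field n) : lim_conj (tower_in n a) = tower_in n (tower_conj n a).
Proof. exact: limmap_emb. Qed.

Lemma tower_in_real n (a : tower_field n) :
  lim_conj (tower_in n a) = tower_in n a <-> tower_conj n a = a.
Proof. by rewrite lim_conj_in; split=> [/fmorph_inj|->]. Qed.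

Lemma task_in n m k : (m <= n)%N ->
  tower_in n (stage_tasks (tower n) m k).1 = tower_in m (pairs (tower m) k).1 /\
  tower_in n (stage_tasks (tower n) m k).2 = tower_in m (pairs (tower m) k).2.
Proof.
elim: n => [|n IHn]; first by rewrite leqn0 => /eqP->.
rewrite leq_eqVlt ltnS => /orP[/eqP->|mn]; first by rewrite tower_task_new.
rewrite tower_task_old //= -[tower_ext n _]/(tower_map n _) -[tower_ext n _.2]/(tower_map n _).
by have [E1 E2] := IHn mn; split; [rewrite -E1; exact: tower_inS | rewrite -E2; exact: tower_inS].
Qed.

Lemma eventually_solved m (c d : tower m) : exists n (c' d' : tower n),
  [/\ tower_in n c' = tower_in m c, tower_in n d' = tower_in m d & solved c' d'].
Proof.
have [k Ek] := pairs_surj (c, d); have [n mn tn] := task_late m k.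
have [E1 E2] := task_in k mn; rewrite Ek in E1 E2.
have := @tower_solved n; rewrite tn => sol.
by exists n.+1; do 2!eexists; split; [exact: (etrans (tower_inS _) E1) |
  exact: (etrans (tower_inS _) E2) | exact: sol].
Qed.

Lemma tower_lim_solved (c d : tower_lim) : lim_conj c = c -> lim_conj d = d -> c != 0 ->
  (exists t, lim_conj t = t /\ t ^+ 2 = d) \/
  (exists x z, lim_conj x = x /\ d + x ^+ 2 = c * (z * lim_conj z)).
Proof.
have [m [c0 [d0 [Ec Ed]]]] := dirlimP2 c d.
have [n [c1 [d1 [E1 E2 sol]]]] := eventually_solved c0 d0.
have {Ec E1} -> : c = tower_in n c1 := etrans Ec (esym E1).
have {Ed E2} -> : d = tower_in n d1 := etrans Ed (esym E2).
move=> /tower_in_real rc /tower_in_real rd; rewrite fmorph_eq0 => nz.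
case: (sol rc rd nz) => [[t [rt E]]|[x [z [rx E]]]]; [left|right].
  exists (tower_in n t); split; first by apply/tower_in_real.
  by rewrite -rmorphXn; congr (tower_in n _).
exists (tower_in n x), (tower_in n z); split; first by apply/tower_in_real.
by rewrite lim_conj_in -rmorphXn -!rmorphM -rmorphD; congr (tower_in n _).
Qed.

Fixpoint from_base n : base_field -> tower_field n :=
  match n with 0 => id | n'.+1 => tower_map n' \o from_base n' end.

Lemma from_base_in n e : tower_in n (from_base n e) = tower_in 0 e.
Proof. by elim: n => //= n IHn; rewrite -IHn; exact: tower_inS. Qed.

Lemma from_base_norm n e : real e -> real (from_base n e : tower n) /\
  (norm (from_base n e : tower n) -> norm e).
Proof.
move=> re; elim: n => [|n [rn Nn]]; first by [].
by split; [exact: emb_real | move=> /(emb_norm rn)].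
Qed.

Lemma tower_lim_norm (e : base_field) : real e -> isnorm lim_conj (tower_in 0 e) -> norm e.
Proof.
move=> re [x]; have [n [z Ez]] := dirlimP x.
have {Ez} -> : x = tower_in n z := Ez.
rewrite -(from_base_in n) lim_conj_in -rmorphM => /fmorph_inj E.
by apply: (from_base_norm n re).2; exists z.
Qed.

(** Here L = k(i) and the two properties of k announced above are expressed with
    norms from L to k. *)
Lemma field_with_linking_norms :
  exists (L : fieldType) (s : {rmorphism L -> L}) (i : L) (e : nat -> L),
  [/\ involutive s, i ^+ 2 = -1, s i = - i & 2%:R != 0 :> L] /\
  [/\ forall j, s (e j) = e j,
      forall j, ~ isnorm s (e j),
      forall j l, j != l -> ~ isnorm s (e j * e l) &
      forall c d, s c = c -> s d = d -> c != 0 ->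
        (exists t, s t = t /\ t ^+ 2 = d) \/
        (exists x z, s x = x /\ d + x ^+ 2 = c * (z * s z))].
Proof.
exists tower_lim, lim_conj, (tower_in 0 (imag base_field)), (fun j => tower_in 0 (base_elt j)).
split; split.
- move=> x; have [n [z Ez]] := dirlimP x.
  have {Ez} -> : x = tower_in n z := Ez.
  by rewrite !lim_conj_in [tower_conj n _]conjK.
- by rewrite -rmorphXn [_ ^+ 2]imag_sqr rmorphN1.
- by rewrite lim_conj_in [tower_conj 0 _]conj_imag rmorphN.
- pose g : {rmorphism algC -> base_field} := @FracField.tofrac {poly algC} \o @polyC algC.
  by rewrite -(rmorph_nat (tower_in 0)) fmorph_eq0 -(rmorph_nat g) fmorph_eq0 Num.Theory.pnatr_eq0.
- by move=> j; apply/tower_in_real; exact: base_real.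
- by move=> j /(tower_lim_norm (base_real j)); exact: base_not_norm.
- move=> j l jl; rewrite -rmorphM => /tower_lim_norm N; apply: (base_mul_not_norm jl); apply: N.
  by rewrite /real rmorphM !base_real.
- exact: tower_lim_solved.
Qed.

(** * The center *)

Section FixedField.
Variables (L : fieldType) (s : {rmorphism L -> L}).

Definition fixed : {pred L} := [pred x | s x == x].

Fact fixed_divring : divring_closed fixed.
Proof.
split; first by rewrite inE rmorph1.
- by move=> x y /eqP sx /eqP sy; rewrite inE rmorphB /= sx sy.
by move=> x y /eqP sx /eqP sy; rewrite inE fmorph_div /= sx sy.
Qed.

HB.instance Definition _ := GRing.isDivringClosed.Build L fixed fixed_divring.

Record fixed_field := Fixed { fixed_val :> L; fixed_valP : fixed_val \in fixed }.

HB.instance Definition _ := [isSub for fixed_val].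
HB.instance Definition _ := [Choice of fixed_field by <:].
HB.instance Definition _ := [SubChoice_isSubIntegralDomain of fixed_field by <:].
HB.instance Definition _ := [SubIntegralDomain_isSubField of fixed_field by <:].
End FixedField.

Definition sum2 (k : fieldType) (c : k) : Prop := exists x y, c = x ^+ 2 + y ^+ 2.

(** With z = x + i y one has z sigma(z) = x^2 + y^2; conversely every z is of this
    form with x = (z + sigma z) / 2 and y = i (sigma z - z) / 2. *)
Lemma linked_sums_of_squares : exists (k : fieldType) (e : nat -> k),
  [/\ 2%:R != 0 :> k,
      forall j, ~ sum2 (e j),
      forall j l, j != l -> ~ sum2 (e j * e l) &
      forall c d : k, c != 0 ->
        (exists t, t ^+ 2 = d) \/
        (exists x y z, d + x ^+ 2 = c * (y ^+ 2 + z ^+ 2))].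
Proof.
have [L [s [i [e [[sK i2 si two] [se Ne Nee sol]]]]]] := field_with_linking_norms.
have inF x : s x = x -> x \in fixed s by rewrite inE => ->.
have valF (x : fixed_field s) : s (val x) = val x by apply/eqP/(valP x).
have sum2_norm (c : fixed_field s) : sum2 c -> isnorm s (val c).
  move=> [x [y ->]]; exists (val x + i * val y).
  have -> : val (x ^+ 2 + y ^+ 2) = val x ^+ 2 - i ^+ 2 * val y ^+ 2.
    by rewrite i2 mulN1r opprK !expr2.
  by rewrite rmorphD rmorphM /= si !valF /=; ring.
have norm_sum2 z : exists x y : fixed_field s, z * s z = val (x ^+ 2 + y ^+ 2).
  have fx : s ((z + s z) / 2%:R) = (z + s z) / 2%:R.
    by rewrite fmorph_div rmorphD /= sK rmorph_nat addrC.
  have fy : s ((s z - z) * i / 2%:R) = (s z - z) * i / 2%:R.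
    by rewrite fmorph_div rmorphM rmorphB /= sK si rmorph_nat; ring.
  exists (Fixed (inF _ fx)), (Fixed (inF _ fy)); rewrite [val _]/=.
  transitivity (((z + s z) / 2%:R) ^+ 2 + ((s z - z) / 2%:R) ^+ 2 * i ^+ 2).
    by rewrite i2; field.
  by rewrite -exprMn mulrAC !expr2.
exists (fixed_field s), (fun j => Fixed (inF _ (se j))); split.
- by rewrite -(inj_eq val_inj) /=.
- by move=> j /sum2_norm; apply: Ne.
- by move=> j l jl /sum2_norm; apply: Nee.
move=> c d c0.
have c0' : val c != 0 by rewrite -(inj_eq val_inj) in c0.
have [[t [st Et]]|[x [z [sx E]]]] := sol (val c) (val d) (valF c) (valF d) c0'.
- by left; exists (Fixed (inF _ st)); apply: val_inj.
right; have [y [w Ez]] := norm_sum2 z; exists (Fixed (inF _ sx)), y, w.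
by apply: val_inj; rewrite /= E Ez.
Qed.

(** * Quaternion algebras (-1, c) *)

(** Coordinates in the basis 1, i, j, ij, where i^2 = -1, j^2 = c and ij = - ji.
    A record, unlike a product of copies of k, carries no other multiplication
    that could be confused with that of the quaternions. *)
Record quat (k : fieldType) (c : k) : Type :=
  mkQ { qre : k; qi : k; qj : k; qk : k }.

Section Quaternions.
Variables (k : fieldType) (c : k).
Local Notation quat := (quat c).
Local Notation mkQ := (@mkQ k c).

Lemma quatE (q : quat) : q = mkQ (qre q) (qi q) (qj q) (qk q).
Proof. by case: q. Qed.

Definition row_of_quat (q : quat) : 'rV[k]_4 :=
  \row_i [:: qre q; qi q; qj q; qk q]`_i.
Definition quat_of_row (v : 'rV[k]_4) : quat :=
  mkQ (v 0 0) (v 0 (inord 1)) (v 0 (inord 2)) (v 0 (inord 3)).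

Lemma row_of_quatK : cancel row_of_quat quat_of_row.
Proof. by move=> q; rewrite [RHS]quatE /quat_of_row !mxE !inordK. Qed.

Lemma quat_of_rowK : cancel quat_of_row row_of_quat.
Proof.
move=> v; apply/rowP => i; rewrite mxE; case: i => -[|[|[|[|//]]]] hi /=;
  by congr (v 0 _); apply: val_inj; rewrite /= ?inordK.
Qed.

HB.instance Definition _ := Choice.copy quat (can_type row_of_quatK).

Definition addq (p q : quat) : quat :=
  mkQ (qre p + qre q) (qi p + qi q) (qj p + qj q) (qk p + qk q).
Definition oppq (p : quat) : quat := mkQ (- qre p) (- qi p) (- qj p) (- qk p).
Definition zeroq : quat := mkQ 0 0 0 0.

Fact addqA : associative addq.
Proof. by move=> p q r; rewrite /addq /= !addrA. Qed.
Fact addqC : commutative addq.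
Proof. by move=> p q; rewrite /addq; congr mkQ; rewrite addrC. Qed.
Fact add0q : left_id zeroq addq.
Proof. by move=> p; rewrite [RHS]quatE /addq /= !add0r. Qed.
Fact addNq : left_inverse zeroq oppq addq.
Proof. by move=> p; rewrite /addq /= !addNr. Qed.
HB.instance Definition _ := GRing.isZmodule.Build quat addqA addqC add0q addNq.

Definition scaleq (t : k) (p : quat) : quat :=
  mkQ (t * qre p) (t * qi p) (t * qj p) (t * qk p).
Fact scaleqA s t p : scaleq s (scaleq t p) = scaleq (s * t) p.
Proof. by rewrite /scaleq /= !mulrA. Qed.
Fact scale1q : left_id 1 scaleq.
Proof. by move=> p; rewrite [RHS]quatE /scaleq !mul1r. Qed.
Fact scaleqDr : right_distributive scaleq +%R.
Proof. by move=> t p q; rewrite /scaleq /= !mulrDr. Qed.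
Fact scaleqDl p : {morph scaleq^~ p : s t / s + t}.
Proof. by move=> s t; rewrite /scaleq /= !mulrDl. Qed.
HB.instance Definition _ :=
  GRing.Zmodule_isLmodule.Build k quat scaleqA scale1q scaleqDr scaleqDl.

Fact quat_vect : Vector.axiom 4 quat.
Proof.
exists row_of_quat; last by exists quat_of_row; [exact: row_of_quatK | exact: quat_of_rowK].
move=> t p q; apply/rowP => i; rewrite !mxE.
by case: i => -[|[|[|[|//]]]] hi.
Qed.
HB.instance Definition _ := Lmodule_hasFinDim.Build k quat quat_vect.

Lemma addqE a b x y a' b' x' y' :
  mkQ a b x y + mkQ a' b' x' y' = mkQ (a + a') (b + b') (x + x') (y + y').
Proof. by []. Qed.

Lemma oppqE a b x y : - mkQ a b x y = mkQ (- a) (- b) (- x) (- y).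
Proof. by []. Qed.

Lemma scaleqE t a b x y : t *: mkQ a b x y = mkQ (t * a) (t * b) (t * x) (t * y).
Proof. by []. Qed.

Definition mulq (p q : quat) : quat := mkQ
  (qre p * qre q - qi p * qi q + c * (qj p * qj q + qk p * qk q))
  (qre p * qi q + qi p * qre q + c * (qk p * qj q - qj p * qk q))
  (qre p * qj q - qi p * qk q + qj p * qre q + qk p * qi q)
  (qre p * qk q + qi p * qj q + qk p * qre q - qj p * qi q).

Definition oneq : quat := mkQ 1 0 0 0.

Fact mulqA : associative mulq.
Proof. move=> p q r; rewrite /mulq; congr mkQ; rewrite /qre /qi /qj /qk /=; ring. Qed.

Fact mul1q : left_id oneq mulq.
Proof. by move=> p; rewrite [RHS]quatE /mulq; congr mkQ; rewrite /qre /qi /qj /qk /=; ring. Qed.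

Fact mulq1 : right_id oneq mulq.
Proof. by move=> p; rewrite [RHS]quatE /mulq; congr mkQ; rewrite /qre /qi /qj /qk /=; ring. Qed.

Fact mulqDl : left_distributive mulq +%R.
Proof.
by move=> [? ? ? ?] [? ? ? ?] [? ? ? ?]; rewrite !addqE; congr mkQ => /=; ring.
Qed.

Fact mulqDr : right_distributive mulq +%R.
Proof.
by move=> [? ? ? ?] [? ? ? ?] [? ? ? ?]; rewrite !addqE; congr mkQ => /=; ring.
Qed.

Fact oneq_neq0 : oneq != 0.
Proof. by apply/eqP => -[/eqP]; rewrite oner_eq0. Qed.

HB.instance Definition _ := GRing.Zmodule_isNzRing.Build (quat)
  mulqA mul1q mulq1 mulqDl mulqDr oneq_neq0.

Lemma mulqE a b x y a' b' x' y' :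
  mkQ a b x y * mkQ a' b' x' y' = mkQ
  (a * a' - b * b' + c * (x * x' + y * y'))
  (a * b' + b * a' + c * (y * x' - x * y'))
  (a * x' - b * y' + x * a' + y * b')
  (a * y' + b * x' + y * a' - x * b').
Proof. by []. Qed.

Fact scaleqAl t (p q : quat) : t *: (p * q) = (t *: p) * q.
Proof.
by rewrite (quatE p) (quatE q) !(scaleqE, mulqE); congr mkQ; ring.
Qed.

HB.instance Definition _ := GRing.Lmodule_isLalgebra.Build k (quat) scaleqAl.

Fact scaleqAr t (p q : quat) : t *: (p * q) = p * (t *: q).
Proof.
by rewrite (quatE p) (quatE q) !(scaleqE, mulqE); congr mkQ; ring.
Qed.

HB.instance Definition _ := GRing.Lalgebra_isAlgebra.Build k (quat) scaleqAr.
HB.instance Definition _ := Algebra_isFalgebra.Build k (quat).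
End Quaternions.

Lemma sum2_aniso (k : fieldType) (x y : k) : (forall t : k, t ^+ 2 <> -1) ->
  x ^+ 2 + y ^+ 2 = 0 -> x = 0 /\ y = 0.
Proof.
move=> neg1_nsq E; have [y0|y0] := eqVneq y 0.
  by move/eqP: E; rewrite y0 expr0n addr0 expf_eq0 => /eqP.
case: (neg1_nsq (x / y)); apply/eqP; rewrite expr_div_n -subr_eq0 opprK -(divff (expf_neq0 2 y0)).
by rewrite -mulrDl E mul0r.
Qed.

(** With a square root t of -1, the form x^2 + y^2 is hyperbolic. *)
Lemma sum2_all (k : fieldType) (t e : k) : 2%:R != 0 :> k -> t ^+ 2 = -1 -> sum2 e.
Proof.
move=> two t2; exists ((e + 1) / 2%:R), (t * ((e - 1) / 2%:R)).
have -> : (t * ((e - 1) / 2%:R)) ^+ 2 = - ((e - 1) / 2%:R) ^+ 2.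
  by rewrite exprMn t2 mulN1r.
by field.
Qed.

(** Reads off u = v from an equation L = R whose two sides differ by a nonzero
    multiple of u - v. *)
Lemma eq_scaled (k : fieldType) (w L R u v : k) :
  w != 0 -> L = R -> w * (u - v) = L - R -> u = v.
Proof.
move=> w0 -> /eqP; rewrite subrr mulf_eq0 (negPf w0) subr_eq0 => /eqP; exact.
Qed.

Section QuaternionTheory.
Variables (k : fieldType) (c : k).
Hypothesis two : 2%:R != 0 :> k.
Hypothesis Nc : ~ sum2 c.

Local Notation D := (quat c).
Local Notation mkQ := (@mkQ k c).

Let neg1_nsq (t : k) : t ^+ 2 <> -1.
Proof. by move/(sum2_all c two)/Nc. Qed.

Let c0 : c != 0.
Proof. by apply: contra_notN Nc => /eqP ->; exists 0, 0; rewrite expr0n addr0. Qed.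

Lemma algqE t : t%:A = mkQ t 0 0 0.
Proof. by rewrite -[1]/(mkQ 1 0 0 0) scaleqE mulr1 mulr0. Qed.

Lemma mem1q (q : D) : reflect (exists t, q = mkQ t 0 0 0) (q \in 1%VS).
Proof. by apply: (iffP (vlineP _ _)) => -[t ->]; exists t; rewrite algqE. Qed.

Definition nrmq (q : D) : k :=
  qre q ^+ 2 + qi q ^+ 2 - c * (qj q ^+ 2 + qk q ^+ 2).

(** The norm form is x^2 + y^2 minus c times another such form.  A nontrivial zero
    would present c as a quotient of two sums of two squares, which is again
    a sum of two squares. *)
Lemma nrmq_eq0 (q : D) : nrmq q = 0 -> q = 0.
Proof.
rewrite /nrmq => /eqP; rewrite subr_eq0 => /eqP E.
have [n0|n0] := eqVneq (qj q ^+ 2 + qk q ^+ 2) 0.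
  move: E; rewrite n0 mulr0 => F; have [E0 E1] := sum2_aniso neg1_nsq F.
  by have [E2 E3] := sum2_aniso neg1_nsq n0; rewrite [q]quatE E0 E1 E2 E3.
case: Nc; exists ((qre q * qj q + qi q * qk q) / (qj q ^+ 2 + qk q ^+ 2)),
  ((qre q * qk q - qi q * qj q) / (qj q ^+ 2 + qk q ^+ 2)).
transitivity ((qre q ^+ 2 + qi q ^+ 2) / (qj q ^+ 2 + qk q ^+ 2)).
  by rewrite E mulfK.
by field.
Qed.

Definition conjq (q : D) : D := mkQ (qre q) (- qi q) (- qj q) (- qk q).

Lemma mul_conjq (q : D) : q * conjq q = (nrmq q)%:A.
Proof. by rewrite algqE; case: q => a b x y; rewrite mulqE /nrmq /=; congr mkQ; ring. Qed.

Lemma conjq_mul (q : D) : conjq q * q = (nrmq q)%:A.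
Proof. by rewrite algqE; case: q => a b x y; rewrite mulqE /nrmq /=; congr mkQ; ring. Qed.

Lemma quat_division : is_division D.
Proof.
move=> q nz; have n0 : nrmq q != 0 by apply: contra_neq nz; exact: nrmq_eq0.
apply/unitrP; exists ((nrmq q)^-1 *: conjq q).
by rewrite -scalerAl -scalerAr mul_conjq conjq_mul scalerA mulVf // scale1r.
Qed.

Lemma quat_central : is_central D.
Proof.
apply/eqP; rewrite eqEsubv; apply/andP; split; last first.
  by rewrite -memvE memv_cap memvf centv1.
apply/subvP => q; rewrite memv_cap => /andP[_ /centvP cq].
have := cq (mkQ 0 1 0 0) (memvf _); have := cq (mkQ 0 0 1 0) (memvf _).
case: q {cq} => a b x y; rewrite !mulqE => -[_ _ _ E3] [_ _ E1 E2].
by apply/mem1q; exists a; congr mkQ; [apply: (eq_scaled two E3)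
  | apply: (eq_scaled two (esym E2)) | apply: (eq_scaled two E1)]; ring.
Qed.

Lemma sqr_pure (b x y : k) :
  mkQ 0 b x y * mkQ 0 b x y = (- b ^+ 2 + c * (x ^+ 2 + y ^+ 2))%:A.
Proof. by rewrite algqE mulqE; congr mkQ; ring. Qed.

(** As t is central, (q - t) (q + t) = q^2 - t^2 = 0. *)
Lemma sqrt_scalar (q : D) t : q * q = (t ^+ 2)%:A -> q \in 1%VS.
Proof.
move=> E; have /eqP : (q - t%:A) * (q + t%:A) = 0.
  rewrite mulrDr !mulrBl E -!scalerAl -!scalerAr !mul1r mulr1.
  by rewrite scalerA -expr2 addrA subrK subrr.
have [q_t _|nz] := eqVneq (q - t%:A) 0.
  by rewrite -[q](subrK t%:A) q_t add0r memvZ // memv_line.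
have U := quat_division nz.
rewrite -(mulr0 (q - t%:A)) (inj_eq (mulrI U)) addr_eq0 => /eqP ->.
by rewrite rpredN memvZ // memv_line.
Qed.

(** Two pure quaternions commute only if they are proportional: up to a nonzero
    factor, the coordinates of the commutator are those of the cross product. *)
Lemma cent_pure (b x y : k) : mkQ 0 b x y != 0 ->
  'C[mkQ 0 b x y]%VS = (1 + <[mkQ 0 b x y]>)%VS.
Proof.
set p := mkQ _ _ _ _ => nz.
apply/eqP; rewrite eqEsubv; apply/andP; split; last first.
  by rewrite subv_add -!memvE cent1v1 cent1v_id.
apply/subvP => -[a' b' x' y'] /cent1vP; rewrite !mulqE => -[_ E1 E2 E3].
have {}E1 : y' * x = x' * y.
  by apply: (eq_scaled (mulf_neq0 two c0) E1); ring.
have {}E2 : y' * b = b' * y.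
  by apply: (eq_scaled two E2); ring.
have {}E3 : x' * b = b' * x.
  by apply: (eq_scaled two (esym E3)); ring.
suff [t Et] : exists t, [/\ b' = t * b, x' = t * x & y' = t * y].
  case: Et => -> -> ->; rewrite (_ : mkQ _ _ _ _ = a'%:A + t *: p); last first.
    by rewrite algqE scaleqE addqE; congr mkQ; ring.
  by apply: memv_add; rewrite memvZ // memv_line.
have [b0|b0] := eqVneq b 0; last first.
  by exists (b' / b); rewrite divfK // mulrAC -E3 mulfK // mulrAC -E2 mulfK.
rewrite b0 in E2 E3 *; rewrite !mulr0 in E2 E3.
have [x0|x0] := eqVneq x 0; last first.
  have b'0 : b' = 0 by apply: (mulIf x0); rewrite mul0r -E3.
  by exists (x' / x); rewrite divfK // b'0 mulr0 mulrAC -E1 mulfK.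
have y0 : y != 0 by apply: contra_neq nz => y0; rewrite /p b0 x0 y0.
have b'0 : b' = 0 by apply: (mulIf y0); rewrite mul0r -E2.
have x'0 : x' = 0 by apply: (mulIf y0); rewrite mul0r -E1 x0 mulr0.
by exists (y' / y); rewrite divfK // b'0 x'0 x0 !mulr0.
Qed.
End QuaternionTheory.

(** * Isomorphism classes and quadratic subalgebras *)

Section AlgebraIso.
Variables (k : fieldType) (A B : falgType k) (f : A -> B).

Definition alg_map (_ : zmod_morphism f) (_ : monoid_morphism f) (_ : scalable f) := f.

Hypotheses (fD : zmod_morphism f) (fM : monoid_morphism f) (fZ : scalable f).
Local Notation g := (alg_map fD fM fZ).
HB.instance Definition _ := GRing.isZmodMorphism.Build A B g fD.
HB.instance Definition _ := GRing.isMonoidMorphism.Build A B g fM.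
HB.instance Definition _ := GRing.isScalable.Build k A B *:%R g fZ.

Lemma algebra_isoI : bijective f -> algebra_iso A B.
Proof. by move=> bf; exists g. Qed.
End AlgebraIso.

Section IsoClass.
Variable k : fieldType.
Implicit Types A B C : falgType k.

Lemma algebra_iso_sym A B : algebra_iso A B -> algebra_iso B A.
Proof.
move=> [f [g fK gK]]; apply: (@algebra_isoI _ _ _ g); last by exists f.
- by move=> x y; apply: (can_inj fK); rewrite rmorphB /= !gK.
- split; first by apply: (can_inj fK); rewrite gK rmorph1.
  by move=> x y; apply: (can_inj fK); rewrite rmorphM /= !gK.
- by move=> a x; apply: (can_inj fK); rewrite linearZ /= !gK.
Qed.

Lemma algebra_iso_trans A B C : algebra_iso A B -> algebra_iso B C -> algebra_iso A C.
Proof.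
by move=> [f bf] [g bg]; exists (g \o f); apply: bij_comp.
Qed.

Lemma iso_class_eq A B : algebra_iso A B -> iso_class A = iso_class B.
Proof.
move=> AB; apply/funext => C; apply/propext; split; apply: algebra_iso_trans => //.
exact: algebra_iso_sym.
Qed.

Lemma iso_class_eqP A B : iso_class A = iso_class B -> algebra_iso A B.
Proof.
move=> /(congr1 (fun P => P B)) AB; rewrite [algebra_iso _ _]AB.
by exists idfun; exists idfun.
Qed.
End IsoClass.

Section QuadraticSubalgebras.
Variables (k : fieldType) (A : falgType k) (a : A).
Hypothesis a1 : a \notin 1%VS.

Lemma quad_uniq s t s' t' : s%:A + t *: a = s'%:A + t' *: a -> s = s' /\ t = t'.
Proof.
move=> E; have tt : t = t'.
  apply/eqP; apply: contraNT a1; rewrite -subr_eq0 => nz.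
  have -> : a = ((t - t')^-1 * (s' - s))%:A.
    rewrite -scalerA scalerBl -[s'%:A](addrK (t' *: a)) -E.
    by rewrite -[_ - t' *: a]addrA addrAC subrr add0r -scalerBl scalerA mulVf // scale1r.
  by rewrite memvZ // memv_line.
split=> //; apply/eqP; move: E; rewrite tt => /addIr /eqP.
rewrite -subr_eq0 -scalerBl scaler_eq0 oner_eq0 orbF subr_eq0 //.
Qed.
End QuadraticSubalgebras.

Lemma mem_quad (k : fieldType) (A : falgType k) (a u : A) :
  u \in (1 + <[a]>)%VS -> exists st : k * k, u = st.1%:A + st.2 *: a.
Proof.
move=> /memv_addP[x /vlineP[s ->] [y /vlineP[t ->] ->]]; by exists (s, t).
Qed.

Lemma quad_mul (k : fieldType) (A : falgType k) (a : A) d s t s' t' : a * a = d%:A ->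
  (s%:A + t *: a) * (s'%:A + t' *: a) =
  (s * s' + t * t' * d)%:A + (s * t' + t * s') *: a.
Proof.
move=> aa; rewrite mulrDl !mulrDr -!scalerAl -!scalerAr !mul1r mulr1 aa !scalerA.
rewrite !scalerDl -!addrA; congr (_ + _); rewrite [RHS]addrCA; congr (_ + _).
by rewrite addrC.
Qed.

(** Both algebras are k[T] / (T^2 - d); the map sends s + t a to s + t b. *)
Lemma quad_iso (k : fieldType) (A B : falgType k) (a : A) (b : B) (d : k)
    (E : {aspace A}) (F : {aspace B}) :
  a \notin 1%VS -> b \notin 1%VS -> a * a = d%:A -> b * b = d%:A ->
  E = (1 + <[a]>)%VS :> {vspace A} -> F = (1 + <[b]>)%VS :> {vspace B} ->
  algebra_iso (subvs_of E) (subvs_of F).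
Proof.
move=> a1 b1 aa bb EE FE.
have inF s t : s%:A + t *: b \in F.
  by rewrite FE; apply: memv_add; rewrite memvZ // memv_line.
have inE' s t : s%:A + t *: a \in E.
  by rewrite EE; apply: memv_add; rewrite memvZ // memv_line.
have /boolp.choice[x xP] (u : subvs_of E) :
    exists st : k * k, val u = st.1%:A + st.2 *: a.
  by apply: mem_quad; rewrite -EE subvsP.
have /boolp.choice[y yP] (u : subvs_of F) :
    exists st : k * k, val u = st.1%:A + st.2 *: b.
  by apply: mem_quad; rewrite -FE subvsP.
have algE : algid E = 1 by apply/eqP; rewrite algid_eq1 -[1]addr0 -[1]scale1r -(scale0r a).
have algF : algid F = 1 by apply/eqP; rewrite algid_eq1 -[1]addr0 -[1]scale1r -(scale0r b).
pose f u : subvs_of F := Subvs (inF (x u).1 (x u).2).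
pose g u : subvs_of E := Subvs (inE' (y u).1 (y u).2).
have fE u s t : val u = s%:A + t *: a -> val (f u) = s%:A + t *: b.
  by rewrite xP => /(quad_uniq a1)[<- <-].
have gE u s t : val u = s%:A + t *: b -> val (g u) = s%:A + t *: a.
  by rewrite yP => /(quad_uniq b1)[<- <-].
apply: (@algebra_isoI _ _ _ f).
- move=> u v; apply: val_inj.
  rewrite (@fE (u - v) ((x u).1 - (x v).1) ((x u).2 - (x v).2)).
    by rewrite !scalerBl raddfB /= opprD addrACA.
  by rewrite raddfB /= !xP !scalerBl opprD addrACA.
- split=> [|u v]; apply: val_inj.
    rewrite (@fE _ 1 0) ?scale1r ?scale0r ?addr0 //.
  rewrite (@fE (u * v) ((x u).1 * (x v).1 + (x u).2 * (x v).2 * d)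
     ((x u).1 * (x v).2 + (x u).2 * (x v).1)) /=.
    by rewrite -(quad_mul _ _ _ _ bb).
  by rewrite -(quad_mul _ _ _ _ aa) -!xP.
- move=> t u; apply: val_inj.
  rewrite (@fE (t *: u) (t * (x u).1) (t * (x u).2)).
    by rewrite -!scalerA -scalerDr.
  by rewrite linearZ /= xP scalerDr !scalerA.
exists g => u; apply: val_inj.
  by rewrite (gE (f u) (x u).1 (x u).2) // -xP.
by rewrite (fE (g u) (y u).1 (y u).2) // -yP.
Qed.

(** * Maximal subfields and isomorphisms of quaternion algebras *)

Section MaximalSubfields.
Variables (k : fieldType) (c : k).
Hypothesis two : 2%:R != 0 :> k.
Hypothesis Nc : ~ sum2 c.

Local Notation D := (quat c).
Local Notation mkQ := (@mkQ k c).

Lemma pure_notin1 (b x y : k) : mkQ 0 b x y != 0 -> mkQ 0 b x y \notin 1%VS.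
Proof. by apply: contraNN => /mem1q[t [_ -> -> ->]]. Qed.

Lemma cent_pure_subfield (b x y : k) : mkQ 0 b x y != 0 ->
  is_subfield ('C[mkQ 0 b x y])%AS.
Proof.
move=> nz; split; first by rewrite -memvE cent1v1.
split=> [u v|u nu]; last first.
  apply: vsval_unitr; apply: (quat_division two Nc).
  by apply: contra_neq nu => u0; apply: val_inj.
have /mem_quad[[s t] Eu] : val u \in (1 + <[mkQ 0 b x y]>)%VS.
  by rewrite -(cent_pure two Nc nz) subvsP.
apply: val_inj; rewrite /= Eu; have /cent1vP E := subvsP v.
by rewrite mulrDl mulrDr -!scalerAl -!scalerAr E mul1r mulr1.
Qed.

Lemma subfield_commute (E : {aspace D}) : is_subfield E ->
  {in E &, commutative *%R}.
Proof.
move=> [_ [comm _]] u v uE vE.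
by have /(congr1 vsval) := comm (Subvs uE) (Subvs vE).
Qed.

(** A subfield containing p centralizes p. *)
Lemma cent_pure_max (b x y : k) : mkQ 0 b x y != 0 ->
  is_maximal_subfield ('C[mkQ 0 b x y])%AS.
Proof.
move=> nz; split; first exact: cent_pure_subfield.
move=> F sF CF; apply: val_inj; apply: subv_anti; rewrite [X in _ && X]CF andbT.
apply/subvP => u uF; apply/cent1vP; apply: (subfield_commute sF) => //.
by apply: (subvP CF); apply: cent1v_id.
Qed.

(** A maximal subfield is not k, since k is contained in k(i).  It thus contains
    a nonzero pure quaternion p, the pure part of any nonscalar element, and is
    contained in the centralizer of p, which is itself a subfield. *)
Lemma maximal_subfieldP (E : {aspace D}) : is_maximal_subfield E ->
  exists b x y, mkQ 0 b x y != 0 /\ E = ('C[mkQ 0 b x y])%AS.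
Proof.
move=> [sE maxE].
have pure_in b x y : mkQ 0 b x y != 0 -> mkQ 0 b x y \in E ->
    E = ('C[mkQ 0 b x y])%AS.
  move=> nz pE; apply/esym/maxE; first exact: cent_pure_subfield.
  by apply/subvP => u uE; apply/cent1vP; apply: (subfield_commute sE).
have i0 : mkQ 0 1 0 0 != 0 by apply/eqP => -[/eqP]; rewrite oner_eq0.
have [E1|/subvPn[v vE v1]] := boolP (E <= 1)%VS.
  case/negP: (pure_notin1 i0); apply: (subvP E1).
  have <- : ('C[mkQ 0 1 0 0])%AS = E.
    apply: maxE; first exact: cent_pure_subfield.
    by apply: subv_trans E1 _; rewrite -memvE cent1v1.
  exact: cent1v_id.
case: v vE v1 => a b x y vE v1; exists b, x, y.
have nz : mkQ 0 b x y != 0.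
  by apply: contraNneq v1 => -[-> -> ->]; apply/mem1q; exists a.
split=> //; apply: pure_in => //.
have -> : mkQ 0 b x y = mkQ a b x y - a%:A.
  by rewrite algqE oppqE addqE; congr mkQ; ring.
by rewrite memvB // memvZ // memvE; case: sE.
Qed.
End MaximalSubfields.

(** The field generated by a pure quaternion p is determined by d = p^2, a
    nonsquare, and the hypothesis gives a pure quaternion with the same square in
    the other algebra. *)
Lemma Max_sub (k : fieldType) (c c' : k) : 2%:R != 0 :> k ->
  ~ sum2 c -> ~ sum2 c' ->
  (forall d : k, (exists t, t ^+ 2 = d) \/
     exists x y z, d + x ^+ 2 = c' * (y ^+ 2 + z ^+ 2)) ->
  forall C, Max (quat c) C -> Max (quat c') C.
Proof.
move=> two Nc Nc' rep C [E mE ->].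
have [b [x [y [nz ->]]]] := maximal_subfieldP two Nc mE.
set d := - b ^+ 2 + c * (x ^+ 2 + y ^+ 2).
have nsq t : t ^+ 2 <> d.
  move=> E'; case/negP: (pure_notin1 nz); apply: (sqrt_scalar two Nc (t := t)).
  by rewrite sqr_pure E'.
case: (rep d) => [[t /nsq //]|[b' [x' [y' Ed]]]].
have Ed' : - b' ^+ 2 + c' * (x' ^+ 2 + y' ^+ 2) = d by rewrite -Ed; ring.
have nz' : mkQ c' 0 b' x' y' != 0.
  apply: contra_notN (nsq 0) => /eqP -[b0 x0 y0].
  by rewrite -Ed' b0 x0 y0; ring.
exists ('C[mkQ c' 0 b' x' y'])%AS; first exact: cent_pure_max.
apply: iso_class_eq; apply: (quad_iso (d := d)).
- exact: pure_notin1 nz.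
- exact: pure_notin1 nz'.
- exact: sqr_pure.
- by rewrite sqr_pure Ed'.
- exact: cent_pure.
- exact: cent_pure.
Qed.

(** The images I and J of the generators i and j of (-1, c) lie in (-1, c').  As
    I^2 = -1, an inner automorphism takes I to the generator i of (-1, c'); then
    it takes J to a square root of c anticommuting with i.  Such an element is
    x j + y ij, and its square is c' (x^2 + y^2). *)
Lemma quat_iso_sum2 (k : fieldType) (c c' : k) : 2%:R != 0 :> k ->
  ~ sum2 c' -> algebra_iso (quat c) (quat c') -> sum2 (c * c').
Proof.
move=> two Nc' [f _].
pose I := f (mkQ c 0 1 0 0); pose J := f (mkQ c 0 0 1 0).
pose i := mkQ c' 0 1 0 0; pose j := mkQ c' 0 0 1 0.
have II : I * I = -1.
  rewrite /I -rmorphM /= sqr_pure rmorph_alg.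
  by rewrite expr0n expr1n /= !addr0 mulr0 addr0 scaleN1r.
have JJ : J * J = c%:A.
  rewrite /J -rmorphM /= sqr_pure rmorph_alg.
  by rewrite !expr0n expr1n /= oppr0 add0r addr0 mulr1.
have IJ : I * J = - (J * I).
  rewrite /I /J -!rmorphM -rmorphN; congr (f _).
  by rewrite !mulqE oppqE; congr mkQ; ring.
have ii : i * i = -1.
  rewrite sqr_pure expr0n expr1n /= !addr0 mulr0 addr0 scaleN1r //.
(* i (i + I) = -1 + i I = (i + I) I; if i + I vanishes, j conjugates I = - i to i. *)
have [u nz uI] : exists2 u : quat c', u != 0 & u * I = i * u.
  have [E|nz] := eqVneq (i + I) 0; last first.
    by exists (i + I) => //; rewrite mulrDl mulrDr II ii addrC.
  exists j; first by apply/eqP => -[/eqP]; rewrite oner_eq0.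
  have -> : I = - i by rewrite -[I]addr0 -(subrr i) [in LHS]addrA [I + i]addrC E add0r.
  by rewrite /i /j oppqE !mulqE; congr mkQ; ring.
have U := quat_division two Nc' nz.
pose K := u * J / u.
have KK : K * K = c%:A.
  by rewrite /K !mulrA divrK // -[u * J * J]mulrA JJ -scalerAr mulr1 -scalerAl divrr //.
have iK : i * K = - (K * i).
  have iu : i = u * I / u by rewrite uI mulrK.
  rewrite [in RHS]iu /K !mulrA divrK // -uI -[u * I * J]mulrA IJ.
  by rewrite -[u * J * I]mulrA mulrN !mulNr.
move: KK iK; rewrite /K; case: (u * J / u) => a b x y KK.
rewrite !mulqE oppqE => -[E1 E2 _ _].
have a0 : a = 0 by apply: (eq_scaled two E2); ring.
have b0 : b = 0 by apply: (eq_scaled two (esym E1)); ring.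
move: KK; rewrite a0 b0 sqr_pure !algqE => -[Ec].
exists (c' * x), (c' * y); rewrite -Ec; ring.
Qed.

(** * Infinite genus *)

Theorem theoremA :
  exists (k : fieldType) (D : falgType k),
    central_division D /\ infinite_pred (Gen D).
Proof.
have [k [e [two Ne Nee rep]]] := linked_sums_of_squares.
have e0 j : e j != 0.
  by apply/eqP => E; apply: (Ne j); exists 0, 0; rewrite E; ring.
have cd j : central_division (quat (e j)).
  by split; [exact: quat_division | exact: quat_central].
have sub j l C : Max (quat (e j)) C -> Max (quat (e l)) C.
  by apply: Max_sub => // d; apply: rep.
have weak j l : weakly_isomorphic (quat (e j)) (quat (e l)).
  by apply/funext => C; apply/propext; split; apply: sub.
exists k, (quat (e 0%N)); split=> // -[n [cl clP]].
(* Were the genus covered by n classes, two of n + 1 of these pairwise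
   nonisomorphic algebras would fall into the same class. *)
have /fin_all_exists[h hP] (j : 'I_n.+1) : exists i, cl i = iso_class (quat (e j)).
  by apply: clP; exists (quat (e j)).
have inj_h : injective h.
  move=> j l E; apply/val_inj/eqP; have := iso_class_eqP (etrans (esym (hP j)) (etrans (congr1 cl E) (hP l))).
  apply: contraPT => jl /(quat_iso_sum2 two (Ne l)); exact: Nee.
by have := leq_card h inj_h; rewrite !card_ord ltnn.
Qed.
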